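(* Let $\varphi$ be a state on the monotone $C^*$-algebra $\mathfrak{M}$. If $$\varphi\lceil_{\mathfrak{M}_o}\circ T_\sigma=\varphi\lceil_{\mathfrak{M}_o}\quad\text{for all }\sigma\in\mathbb{P}_\mathbb{Z},$$ then $\varphi=(1-x)\omega_\infty+x\omega$ for some $x\in[0,1]$, where $\omega$ is the vacuum state and $\omega_\infty$ is the state at infinity.
   Context: For $k\ge 1$ let $I_k=\{(i_1,\dots,i_k)\mid i_1<\cdots<i_k,\ i_j\in\mathbb{Z}\}$. The discrete monotone Fock space is $\mathcal{F}_m=\bigoplus_{k=0}^\infty\mathcal{H}_k$ with $\mathcal{H}_0=\mathbb{C}\Omega$ and $\mathcal{H}_k=\ell^2(I_k)$ for $k\ge1$, with canonical orthonormal basis $e_{(i_1,\dots,i_k)}$, $e_\emptyset=\Omega$. For $i\in\mathbb{Z}$ the monotone creator and annihilator are the mutually adjoint bounded operators $$a_i^\dagger e_{(i_1,\dots,i_k)}=\begin{cases}e_{(i,i_1,\dots,i_k)}&\text{if } i<i_1,\\0&\text{otherwise,}\end{cases}\qquad a_i e_{(i_1,\dots,i_k)}=\begin{cases}e_{(i_2,\dots,i_k)}&\text{if } k\ge1,\ i=i_1,\\0&\text{otherwise,}\end{cases}$$ with $a_i^\dagger\Omega=e_{(i)}$. $\mathfrak{M}_o\subset\mathcal{B}(\mathcal{F}_m)$ is the unital $*$-algebra generated by $\{a_i\}_{i\in\mathbb{Z}}$, and $\mathfrak{M}$ is its norm closure (a unital $C^*$-algebra). A state is a positive normalised linear functional.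 A Hamel basis $\{X_{(\lambda_1,\lambda_2)}\}$ of $\mathfrak{M}_o$ is indexed by all pairs $(\lambda_1,\lambda_2)$ of finite (possibly empty) subsets of $\mathbb{Z}$: $X_{(\emptyset,\emptyset)}=I$; $X_{(\{i\},\{i\})}=a_ia_i^\dagger$; and for any other $(\lambda_1,\lambda_2)=(\{i_1<\cdots<i_m\},\{j_n<\cdots<j_1\})$, $X_{(\lambda_1,\lambda_2)}=a_{i_1}^\dagger\cdots a_{i_m}^\dagger a_{j_1}\cdots a_{j_n}$. $\mathbb{P}_\mathbb{Z}$ is the group of finite permutations of $\mathbb{Z}$ (bijections moving only finitely many points). For a finite set $I=\{i_1<\cdots<i_m\}\subset\mathbb{Z}$, write $\sigma\in OP(I)$ if $\sigma(i_h)<\sigma(i_{h+1})$ for each $h=1,\dots,m-1$ (no condition if $m\le1$). For $\sigma\in\mathbb{P}_\mathbb{Z}$, $T_\sigma:\mathfrak{M}_o\to\mathfrak{M}_o$ is the linear map determined on the basis by $T_\sigma(X_{(\lambda_1,\lambda_2)})=X_{(\sigma(\lambda_1),\sigma(\lambda_2))}$ if $\sigma\in OP(\lambda_1)\cap OP(\lambda_2)$, and $T_\sigma(X_{(\lambda_1,\lambda_2)})=0$ otherwise. The vacuum state is $\omega(Y)=\langle Y\Omega,\Omega\rangle$. Let $\mathfrak{A}$ be the norm closure of the linear span of all $X_{(\lambda_1,\lambda_2)}$ with $(\lambda_1,\lambda_2)\ne(\emptyset,\emptyset)$ (equivalently, of all words of positive length of the form $a_{i_1}^\dagger\cdots a_{i_m}^\dagger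 a_{j_1}\cdots a_{j_n}$ or $a_{i_1}^\dagger\cdots a_{i_m}^\dagger a_ka_k^\dagger a_{j_1}\cdots a_{j_n}$ with $i_1<\cdots<i_m<k>j_1>\cdots>j_n$ in the latter case and $i_1<\cdots<i_m$, $j_1>\cdots>j_n$ in the former). Every element of $\mathfrak{M}$ is uniquely of the form $X+cI$ with $X\in\mathfrak{A}$, $c\in\mathbb{C}$, and the state at infinity is $\omega_\infty(X+cI)=c$. *)

(* Defs.v *)
From HB Require Import structures.
From mathcomp Require Import all_boot all_order all_algebra.
From mathcomp Require Import finmap.
From mathcomp Require Import complex ring lra.
From mathcomp Require Import mathcomp_extra boolp classical_sets functions.
From mathcomp Require Import cardinality fsbigop reals ereal esum.

Set Implicit Arguments.
Unset Strict Implicit.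
Unset Printing Implicit Defensive.
Import Order.TTheory GRing.Theory Num.Theory ComplexField.Normc.

Local Open Scope classical_set_scope.
Local Open Scope ring_scope.
Local Open Scope complex_scope.

(* Unordered sums of absolutely summable families, through the library's sums
   \esum of nonnegative families.  Meaningful only in the absolutely summable
   case, which covers every use below. *)
Section Sums.
Context (R : realType) (J : choiceType).

Definition rsum (f : J -> R) : R :=
  fine (\esum_(s in [set: J]) (Num.max (f s) 0)%:E) -
  fine (\esum_(s in [set: J]) (Num.max (- f s) 0)%:E).

Definition csum (f : J -> R[i]) : R[i] :=
  rsum (fun s => complex.Re (f s)) +i* rsum (fun s => complex.Im (f s)).

End Sums.

Section L2.
Context (R : realType) (J : choiceType).

Definition sqsummable : {pred J -> R[i]} :=
  [pred x : J -> R[i] |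
    (\esum_(s in [set: J]) (normc (x s) ^+ 2)%:E < +oo)%E].

Record l2 : Type := L2 { l2val :> J -> R[i]; l2P : l2val \in sqsummable }.

HB.instance Definition _ := [isSub for l2val].
HB.instance Definition _ := [Choice of l2 by <:].

Lemma sqsummable_submod : submod_closed sqsummable.
Proof.
split=> [|a x y].
  rewrite inE /= esum1 ?ltry// => s _.
  by rewrite expr0n addr0 sqrtr0 expr0n.
rewrite !inE /= => fx fy.
pose b := normc a ^+ 2.
have b0 : 0 <= b by exact: sqr_ge0.
have mul2 (k : R) (z : J -> R[i]) : 0 <= k ->
    (\esum_(s in [set: J]) (normc (z s) ^+ 2)%:E < +oo)%E ->
    (\esum_(s in [set: J]) (k * normc (z s) ^+ 2)%:E < +oo)%E.
  move=> k0 fz; apply: (@le_lt_trans _ _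
    (k%:E * \esum_(s in [set: J]) (normc (z s) ^+ 2)%:E)%E); last first.
    by rewrite lte_mul_pinfty.
  apply: ge_ereal_sup => _ [X [finX XJ] <-].
  rewrite (eq_fsbigr (fun s => k%:E * (normc (z s) ^+ 2)%:E)%E)//.
  rewrite -ge0_mule_fsumr; last by move=> s; rewrite lee_fin sqr_ge0.
  apply: lee_wpmul2l; first by rewrite lee_fin.
  by apply: ereal_sup_ubound; exists X.
apply: (@le_lt_trans _ _ (\esum_(s in [set: J])
  ((2 * b * normc (x s) ^+ 2)%:E + (2 * normc (y s) ^+ 2)%:E))%E).
  apply: le_esum => s _; rewrite -EFinD lee_fin.
  have h := le_normcD (a * x s) (y s).
  have n0 (z : R[i]) : 0 <= normc z by case: z => ? ?; exact: sqrtr_ge0.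
  rewrite /b -mulrA -exprMn -normcM -[(a *: x + y) s]/(a * x s + y s).
  apply: (@le_trans _ _ ((normc (a * x s) + normc (y s)) ^+ 2)).
    by rewrite lerXn2r ?nnegrE ?addr_ge0.
  rewrite -subr_ge0 (_ : _ - _ = (normc (a * x s) - normc (y s)) ^+ 2).
    exact: sqr_ge0.
  by ring.
rewrite esumD.
- by rewrite lte_add_pinfty// mul2// mulr_ge0.
- by move=> s _; apply: mulr_ge0; [apply: mulr_ge0|exact: sqr_ge0].
- by move=> s _; apply: mulr_ge0; [|exact: sqr_ge0].
Qed.

HB.instance Definition _ := GRing.isSubmodClosed.Build _ _ sqsummable
  sqsummable_submod.
HB.instance Definition _ := [SubChoice_isSubLmodule of l2 by <:].

End L2.

Section Operators.
Context (R : realType) (J : choiceType).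
Local Notation H := (l2 R J).
Local Notation op := (H -> H).
Implicit Types (x y : H) (A B : op).

Definition inner x y : R[i] := csum (fun s => x s * (y s)^*).

Definition l2norm x : R := Num.sqrt (complex.Re (inner x x)).

(* Extended-real valued: +oo on unbounded linear maps. *)
Definition opnorm A : \bar R :=
  ereal_sup [set (l2norm (A x))%:E | x in [set x | l2norm x <= 1]].

Definition bounded_op : set op := [set A | linear A /\ (opnorm A < +oo)%E].

Definition is_adjoint A B : Prop := forall x y, inner (A x) y = inner x (B y).

Definition norm_closure (S : set op) : set op :=
  [set A | bounded_op A /\
    forall e : R, 0 < e -> exists2 B, S B & (opnorm (A - B)%R < e%:E)%E].

(* The unital *-algebra generated by G. *)
Inductive star_alg (G : set op) : op -> Prop :=
| star_alg_gen A : G A -> star_alg G A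
| star_alg_id : star_alg G id
| star_alg_lin (c : R[i]) A B :
    star_alg G A -> star_alg G B -> star_alg G (c *: A + B)
| star_alg_comp A B : star_alg G A -> star_alg G B -> star_alg G (A \o B)
| star_alg_adj A B : star_alg G A -> is_adjoint A B -> star_alg G B.

(* A functional on a *-algebra M of operators is represented by a function on
   all operators whose values outside M are irrelevant. *)
Record is_state (M : set op) (phi : op -> R[i]) : Prop := IsState {
  state_linear : forall (c : R[i]) A B, M A -> M B ->
    phi (c *: A + B) = c * phi A + phi B;
  state_pos : forall A B, M A -> is_adjoint A B -> 0 <= phi (B \o A);
  state_unit : phi id = 1 }.

End Operators.

(* Strictly increasing finite sequences of integers: the disjoint union of the
   one-point set (for the vacuum) and of all the I_k, k >= 1.  Hence l2 over
   this index set is the Hilbert sum of the l2(I_k). *)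
Definition incr_seq : Type := {s : seq int | sorted <%R s}.

HB.instance Definition _ := Choice.on incr_seq.

Definition nil_seq : incr_seq := exist _ [::] isT.

Section Fock.
Context (R : realType).
Local Notation H := (l2 R incr_seq).

Section PartialReindexing.
Variable f : incr_seq -> option incr_seq.
Hypothesis f_inj : forall s s' t, f s = Some t -> f s' = Some t -> s = s'.

Lemma pullback_subproof (x : H) :
  (fun s => oapp x 0 (f s)) \in @sqsummable R incr_seq.
Proof.
rewrite inE /=.
apply: le_lt_trans (l2P x).
pose D := [set s | f s].
pose g s := odflt nil_seq (f s).
have gi : set_inj D g.
  move=> s s'; rewrite !inE /D /g /=.
  case E : (f s) => [t|//] _; case E' : (f s') => [t'|//] _ /= tt'.
  by apply: (f_inj E); rewrite E' tt'.
rewrite (_ : esum _ _ = \esum_(s in D) (normc (x (g s)) ^+ 2)%:E).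
  rewrite -(esum_image _ _ (fun t => (normc (x t) ^+ 2)%:E) gi) esum_mkcond.
  apply: le_esum => s _; case: ifP => // _.
  by rewrite lee_fin sqr_ge0.
rewrite [RHS]esum_mkcond; apply: eq_esum => s _.
rewrite /g; case E : (f s) => [t|].
  by rewrite mem_set // /D /= E.
by rewrite memNset ?/D /= ?E // expr0n /= addr0 sqrtr0 expr0n.
Qed.

Definition pullback (x : H) : H := L2 (pullback_subproof x).
End PartialReindexing.

Definition tail_at (i : int) (s : incr_seq) : option incr_seq :=
  if val s is j :: t then if j == i then insub t else None else None.

Definition cons_at (i : int) (s : incr_seq) : option incr_seq :=
  insub (i :: val s).

Lemma tail_atP i s t : tail_at i s = Some t <-> val s = i :: val t.
Proof.
case: s => -[|j s] ss; rewrite /tail_at /=; first by split.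
case: eqP => [->|ji]; last by split=> // -[].
have st : sorted <%R s by exact: path_sorted ss.
rewrite (insubT (sorted <%R) st).
by split=> [[<-]//|[e]]; congr Some; apply: val_inj.
Qed.

Lemma cons_atP i s t : cons_at i s = Some t <-> val t = i :: val s.
Proof.
rewrite /cons_at; case: insubP => [u _ <-|ss].
  by split=> [[->]//|/val_inj ->].
by split=> // e; rewrite -e (valP t) in ss.
Qed.

Lemma tail_at_inj i s s' t :
  tail_at i s = Some t -> tail_at i s' = Some t -> s = s'.
Proof. by move=> /tail_atP h /tail_atP h'; apply: val_inj; rewrite h h'. Qed.

Lemma cons_at_inj i s s' t :
  cons_at i s = Some t -> cons_at i s' = Some t -> s = s'.
Proof. by move=> /cons_atP h /cons_atP; rewrite h => -[] /val_inj. Qed.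

(* Coordinatewise, (a_i^* x)_s is x_t if s = (i, t), and 0 otherwise, while
   (a_i x)_s is x_(i, s) if (i, s) is increasing, and 0 otherwise; see the
   lemmas creation_basis and annihilation_basis. *)
Definition creation (i : int) : H -> H := pullback (@tail_at_inj i).

Definition annihilation (i : int) : H -> H := pullback (@cons_at_inj i).

Lemma basis_subproof (s : incr_seq) :
  (fun t => (t == s)%:R) \in @sqsummable R incr_seq.
Proof.
rewrite inE /= (_ : esum _ _ = \esum_(t in [set s]) 1%E).
  by rewrite esum_set1 ?ltry.
rewrite [RHS]esum_mkcond; apply: eq_esum => t _.
case: (eqVneq t s) => [->|ts].
  by rewrite mem_set // normc1 expr1n.
by rewrite memNset ?normc0 ?expr0n //; apply/eqP.
Qed.

Definition basis_vec (s : incr_seq) : H := L2 (basis_subproof s).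

Lemma creation_basis i s :
  creation i (basis_vec s) = oapp basis_vec 0 (cons_at i s).
Proof.
apply/val_inj/funext => t /=.
have tc u : tail_at i t = Some u <-> cons_at i u = Some t.
  by rewrite tail_atP cons_atP.
case E : (tail_at i t) => [u|]; case F : (cons_at i s) => [v|] //=.
- congr (nat_of_bool _)%:R; apply/idP/idP => /eqP h; apply/eqP.
    by move/tc: E; rewrite h F => -[].
  by move: F; rewrite -h => /tc; rewrite E => -[].
- by case: eqP => // us; move/tc: E; rewrite us F.
- by case: eqP => // tv; move: F; rewrite -tv => /tc; rewrite E.
Qed.

Lemma annihilation_basis i s :
  annihilation i (basis_vec s) = oapp basis_vec 0 (tail_at i s).
Proof.
apply/val_inj/funext => t /=.
have tc u v : tail_at i v = Some u <-> cons_at i u = Some v.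
  by rewrite tail_atP cons_atP.
case E : (cons_at i t) => [u|]; case F : (tail_at i s) => [v|] //=.
- congr (nat_of_bool _)%:R; apply/idP/idP => /eqP h; apply/eqP.
    by move/tc: E; rewrite h F => -[].
  by move/tc: F; rewrite -h E => -[].
- by case: eqP => // us; move/tc: E; rewrite us F.
- by case: eqP => // tv; move/tc: F; rewrite -tv E.
Qed.

Lemma esum_pinv (f g : incr_seq -> option incr_seq)
    (G : incr_seq -> incr_seq -> \bar R) :
  (forall s t, f s = Some t <-> g t = Some s) ->
  \esum_(s in [set: incr_seq]) oapp (G s) 0%E (f s) =
  \esum_(t in [set: incr_seq]) oapp (G ^~ t) 0%E (g t).
Proof.
move=> fg; pose D (h : incr_seq -> option incr_seq) := [set s | h s].
pose e (h : incr_seq -> option incr_seq) s := odflt nil_seq (h s).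
have toD h (K : incr_seq -> incr_seq -> \bar R) :
    \esum_(s in [set: incr_seq]) oapp (K s) 0%E (h s) =
    \esum_(s in D h) K s (e h s).
  rewrite [RHS]esum_mkcond; apply: eq_esum => s _.
  rewrite /e; case E : (h s) => [t|].
    by rewrite mem_set // /D /= E.
  by rewrite memNset ?/D /= ?E.
have bij : set_bij (D g) (D f) (e g).
  split.
  - move=> t; rewrite /D /e /=; case E : (g t) => [s|//] _ /=.
    by move/fg: E => ->.
  - move=> t t'; rewrite !inE /D /e /=.
    case E : (g t) => [s|//] _; case E' : (g t') => [s'|//] _ /= ss'.
    by move/fg: E; move/fg: E'; rewrite ss' => -> -[].
  - move=> s; rewrite /D /=; case E : (f s) => [t|//] _.
    by move/fg: E => E; exists t => //; rewrite /D /e /= E.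
rewrite !toD (reindex_esum _ _ _ _ bij); apply: eq_esum => t.
rewrite /D /e /=; case E : (g t) => [s|//] _ /=.
by move/fg: E => ->.
Qed.

Lemma annihilation_adjoint i : is_adjoint (annihilation i) (creation i).
Proof.
move=> x y; rewrite /inner /csum.
have tc s t : cons_at i s = Some t <-> tail_at i t = Some s.
  by rewrite tail_atP cons_atP.
have key (p : R[i] -> R) : p 0 = 0 ->
    rsum (fun s => p (annihilation i x s * (y s)^*)) =
    rsum (fun s => p (x s * (creation i y s)^*)).
  move=> p0; rewrite /rsum; congr (fine _ - fine _).
    pose G s t : \bar R := (Num.max (p (x t * (y s)^*)) 0)%:E.
    transitivity (\esum_(s in [set: incr_seq]) oapp (G s) 0%E (cons_at i s)).
      by apply: eq_esum => s _ /=; case: cons_at => //=; rewrite mul0r p0 maxxx.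
    rewrite (esum_pinv _ tc); apply: eq_esum => t _ /=.
    by case: tail_at => [u|] //=; rewrite rmorph0 mulr0 p0 maxxx.
  pose G s t : \bar R := (Num.max (- p (x t * (y s)^*)) 0)%:E.
  transitivity (\esum_(s in [set: incr_seq]) oapp (G s) 0%E (cons_at i s)).
    by apply: eq_esum => s _ /=; case: cons_at => //=;
      rewrite mul0r p0 oppr0 maxxx.
  rewrite (esum_pinv _ tc); apply: eq_esum => t _ /=.
  by case: tail_at => //=; rewrite rmorph0 mulr0 p0 oppr0 maxxx.
by congr (_ +i* _); apply: key.
Qed.

Definition vacuum_vec : H := basis_vec nil_seq.

End Fock.

Section MonotoneAlgebra.
Context (R : realType).
Local Notation C := R[i].
Local Notation H := (l2 R incr_seq).
Local Notation op := (H -> H).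
Local Notation index := ({fset int} * {fset int})%type.

Definition mono_star_alg : set op := star_alg (range (@annihilation R)).

Definition mono_Cstar_alg : set op := norm_closure mono_star_alg.

Definition incr_enum (I : {fset int}) : seq int := sort <=%R (enum_fset I).

Definition word (ci aj : seq int) : op :=
  foldr (fun i A => creation i \o A)
    (foldr (fun j A => annihilation j \o A) id aj) ci.

(* The exceptional basis vector ({i}, {i}) is a_i a_i^*, not a_i^* a_i. *)
Definition hamel (l : index) : op :=
  match incr_enum l.1, incr_enum l.2 with
  | [:: i], [:: j] =>
      if i == j then annihilation i \o creation i else word [:: i] [:: j]
  | ci, ja => word ci (rev ja)
  end.

Definition finite_perm (sigma : int -> int) : Prop :=
  bijective sigma /\ finite_set [set i | sigma i != i].

Definition OP (sigma : int -> int) (I : {fset int}) : bool :=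
  sorted <%R (map sigma (incr_enum I)).

Definition fsupp (c : index -> C) : set index := [set l | c l != 0].

Definition lincomb (c : index -> C) : op :=
  \sum_(l \in [set: index]) c l *: hamel l.

(* The coordinates of an element of mono_star_alg in the Hamel basis, picked by
   classical choice (they are unique, the family hamel being free). *)
Definition hamel_coord (A : op) : index -> C :=
  xget 0 [set c | finite_set (fsupp c) /\ A = lincomb c].

Definition hamel_perm (sigma : int -> int) (l : index) : op :=
  if OP sigma l.1 && OP sigma l.2
  then hamel ([fset sigma i | i in l.1]%fset, [fset sigma i | i in l.2]%fset)
  else 0.

(* The linear extension of the map hamel l |-> hamel_perm sigma l. *)
Definition T_perm (sigma : int -> int) (A : op) : op :=
  \sum_(l \in [set: index]) hamel_coord A l *: hamel_perm sigma l.

Definition vacuum_state (A : op) : C := inner (A (vacuum_vec R)) (vacuum_vec R).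

Definition frakA : set op :=
  norm_closure [set A | exists c : index -> C,
    [/\ finite_set (fsupp c), c (fset0, fset0) = 0 & A = lincomb c]].

(* The unique c such that A = X + c I with X in frakA, picked by classical
   choice. *)
Definition state_at_infinity (A : op) : C :=
  xget 0 [set c : C | frakA (A - c *: (id : op))].

End MonotoneAlgebra.

(* Main.v *)
Require Import Defs.
From HB Require Import structures.
From mathcomp Require Import all_boot all_order all_algebra.
From mathcomp Require Import finmap.
From mathcomp Require Import complex ring lra zify.
From mathcomp Require Import mathcomp_extra boolp classical_sets functions.
From mathcomp Require Import cardinality fsbigop reals ereal esum.

(** Write a_i for the annihilators, a_i^+ for the creators, and P_i = a_i a_i^+,
    the projection onto the span of the basis vectors of the vacuum and of the
    sequences that start strictly after i.

    On the algebra of finite combinations the result is an algebraic identity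
    plus the Cauchy-Schwarz inequality.  A transposition that exchanges i and j
    sends P_i to P_j, since a singleton is never reordered; so an invariant
    state phi takes the same value x on all the P_i.  Now a_i^+ a_i is the
    projection onto the sequences that start at i, that is,
      a_i^+ a_i = P_(i-1) - P_i,
    hence phi (a_i^+ a_i) = 0.  By Cauchy-Schwarz phi then vanishes on every
    product that starts with a creator or ends with an annihilator, which are
    all the elements of the Hamel basis except the identity and the P_i.  The
    vacuum state is 1 on the identity and on the P_i, and 0 on the others, while
    the state at infinity reads off the coefficient of the identity.  So phi is
    (1 - x) omega_infinity + x omega on finite combinations; and 0 <= x <= 1
    since P_0 is a projection.

    Three further facts are used.

    - The map T_sigma is defined through coordinates in the Hamel basis, so the
      transport of P_i to P_j rests on the freeness of that family
      (lincomb_inj).  Matrix entries of the basis elements are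
      0 or 1, and one entry, or a difference of two entries, isolates any given
      element other than the identity (hamel_dual): for most words the two
      entries are at pairs of sequences that differ by a common last letter.

    - Every element of the algebra is a combination of the Hamel basis
      (star_alg_in_span).  The family of all a_p^+ P_k a_q, together with the
      identity, is stable under left multiplication by the generators, and each
      of its members telescopes to Hamel words.

    - The equality extends to the norm closure only because phi is norm
      continuous (state_bounded), which is where the completeness of the closure
      enters: if A is small then 1 - A^* A is the square of a self-adjoint
      element of the closure, namely 1 - Y where Y is the limit of the
      contracting iteration Y |-> (A^* A + Y^2) / 2; so phi (A^* A) <= 1.

    If x = 1 the state at infinity does not contribute.  If x < 1 the scalar
    (phi A - x omega A) / (1 - x) is the limit of the coefficients of the
    identity in finite combinations that approach A, so it is the value of the
    state at infinity at A.  That value is unique, because a combination without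
    identity term has a zero diagonal entry at the sequence (k) for k far enough
    to the left. *)

Set Implicit Arguments.
Unset Strict Implicit.
Unset Printing Implicit Defensive.
Import Order.TTheory GRing.Theory Num.Theory ComplexField.Normc.
Local Open Scope classical_set_scope.
Local Open Scope complex_scope.
Local Open Scope ring_scope.

(** * Complex numbers and the Cauchy-Schwarz discriminant *)

Section ComplexNumbers.
Context (R : realType).
Implicit Types z w : R[i].

Lemma normc_ge0 z : 0 <= normc z.
Proof. by case: z => a b; exact: sqrtr_ge0. Qed.

Lemma normc_conj z : normc z^* = normc z.
Proof. by case: z => a b; rewrite /= sqrrN. Qed.

Lemma conjcD z w : (z + w)^* = z^* + w^*.
Proof. exact: rmorphD. Qed.

Lemma conjcB z w : (z - w)^* = z^* - w^*.
Proof. exact: rmorphB. Qed.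

Lemma conjcM z w : (z * w)^* = z^* * w^*.
Proof. exact: rmorphM. Qed.

Lemma normc_sqr z : normc z ^+ 2 = complex.Re z ^+ 2 + complex.Im z ^+ 2.
Proof. by case: z => a b /=; rewrite sqr_sqrtr// addr_ge0 ?sqr_ge0. Qed.

Lemma mulcJ z : z * z^* = (normc z ^+ 2)%:C.
Proof.
rewrite normc_sqr; case: z => a b; apply/eqP; rewrite eq_complex /=.
by apply/andP; split; apply/eqP; ring.
Qed.

Lemma normc_real (a : R) : normc a%:C = `|a|.
Proof. by rewrite /= expr0n addr0 sqrtr_sqr. Qed.

Lemma ler_Re_normc z : `|complex.Re z| <= normc z.
Proof.
by rewrite -ler_sqr ?nnegrE ?normc_ge0// normc_sqr real_normK ?num_real// lerDl sqr_ge0.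
Qed.

Lemma ler_Im_normc z : `|complex.Im z| <= normc z.
Proof.
by rewrite -ler_sqr ?nnegrE ?normc_ge0// normc_sqr real_normK ?num_real// lerDr sqr_ge0.
Qed.

Lemma ler_normc_ReIm z : normc z <= `|complex.Re z| + `|complex.Im z|.
Proof.
rewrite -ler_sqr ?nnegrE ?normc_ge0 ?addr_ge0// normc_sqr sqrrD.
rewrite !real_normK ?num_real//.
by rewrite lerD2r lerDl mulrn_wge0// mulr_ge0.
Qed.

(** The form is the expansion of <A + t B, A + t B> for a positive sesquilinear
    form.  Real and imaginary t force the symmetry b' = b^*, and the minimum over
    t gives the discriminant inequality.  Used both for the inner product of l2
    and for the form phi (B^* A) of a state. *)
Lemma sesqui_form_bound (a b b' c : R[i]) : 0 <= a -> 0 <= c ->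
  (forall t : R[i], 0 <= a + t * b + t^* * b' + t * t^* * c) ->
  b' = b^* /\ normc b ^+ 2 <= complex.Re a * complex.Re c.
Proof.
case: a b b' c => [a0 a1] [b0 b1] [d0 d1] [c0 c1].
rewrite !lecE /= => /andP[/eqP -> ha] /andP[/eqP -> hc] pos.
have h (t0 t1 : R) : (t0 * b1 + t1 * b0 + t0 * d1 - t1 * d0 = 0) /\
  0 <= a0 + t0 * b0 - t1 * b1 + t0 * d0 + t1 * d1 + (t0 ^+ 2 + t1 ^+ 2) * c0.
  have := pos (t0 +i* t1); rewrite lecE /= => /andP[/eqP e i]; split.
    by rewrite -e; ring.
  by apply: le_trans i _; rewrite le_eqVlt; apply/orP; left; apply/eqP; ring.
have [e1 _] := h 1 0; have [e2 _] := h 0 1.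
have E1 : d1 = - b1 by lra.
have E0 : d0 = b0 by lra.
subst d0 d1; split=> //.
rewrite sqr_sqrtr ?addr_ge0 ?sqr_ge0//.
have [c00|cn0] := eqVneq c0 0; last first.
  have [_] := h (- b0 / c0) (b1 / c0).
  have cp : 0 < c0 by rewrite lt_neqAle eq_sym cn0.
  move=> i.
  have := mulr_ge0 i (ltW cp); rewrite -subr_ge0.
  set x := (X in 0 <= X); set y := (X in _ -> 0 <= X).
  suff -> : x = y by [].
  by rewrite /x /y; field.
subst c0; rewrite mulr0.
rewrite leNgt; apply/negP => bp.
(* With c = 0 the form is affine in t, so it can stay nonnegative only if b = 0:
   this t gives the value a - (a + 1) = -1. *)
have [_] := h (- (a0 + 1) / (2 * (b0 ^+ 2 + b1 ^+ 2)) * b0)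
  ((a0 + 1) / (2 * (b0 ^+ 2 + b1 ^+ 2)) * b1).
set x := (X in 0 <= X).
suff -> : x = -1 by rewrite lerNr oppr0 ler10.
rewrite /x; field.
by rewrite gt_eqF.
Qed.

End ComplexNumbers.

(** * Linearity of unordered sums *)

Section Sums.
Context (R : realType) (J : choiceType).

(** Absolute summability is what makes the difference of the sums of positive and
    negative parts additive. *)
Definition abssum (f : J -> R) := (\esum_(s in [set: J]) `|f s|%:E < +oo)%E.

Lemma esum_fin (f : J -> R) : (forall s, 0 <= f s) ->
  (\esum_(s in [set: J]) (f s)%:E < +oo)%E ->
  \esum_(s in [set: J]) (f s)%:E = (fine (\esum_(s in [set: J]) (f s)%:E))%:E.
Proof.
move=> f0 fs; rewrite fineK// ge0_fin_numE//.
by apply: esum_ge0 => s _; rewrite lee_fin.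
Qed.

Lemma esumZl (k : R) (f : J -> R) : 0 <= k -> (forall s, 0 <= f s) ->
  (\esum_(s in [set: J]) (f s)%:E < +oo)%E ->
  \esum_(s in [set: J]) (k * f s)%:E = (k%:E * \esum_(s in [set: J]) (f s)%:E)%E.
Proof.
move=> k0 f0 fs.
have le (k' : R) (g : J -> R) : 0 <= k' -> (forall s, 0 <= g s) ->
    (\esum_(s in [set: J]) (k' * g s)%:E <= k'%:E * \esum_(s in [set: J]) (g s)%:E)%E.
  move=> k'0 g0; apply: ge_ereal_sup => _ [X [finX XJ] <-].
  rewrite (eq_fsbigr (fun s => k'%:E * (g s)%:E)%E)//.
  rewrite -ge0_mule_fsumr; last by move=> s; rewrite lee_fin.
  apply: lee_wpmul2l; first by rewrite lee_fin.
  by apply: ereal_sup_ubound; exists X.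
apply/le_anti/andP; split; first exact: le.
have [->|kn0] := eqVneq k 0.
  by rewrite mul0e; apply: esum_ge0 => s _; rewrite mul0r.
have kp : 0 < k by rewrite lt_neqAle eq_sym kn0.
have := @le k^-1 (fun s => k * f s).
rewrite invr_ge0 => /(_ k0) /(_ (fun s => mulr_ge0 k0 (f0 s))).
under eq_esum do rewrite mulKf//.
move=> /(lee_wpmul2l (x := k%:E)); rewrite lee_fin => /(_ k0).
by rewrite muleA -EFinM divff// mul1e.
Qed.

Lemma abssum_le (f g : J -> R) : (forall s, `|f s| <= `|g s|) -> abssum g -> abssum f.
Proof.
move=> fg; apply: le_lt_trans; apply: le_esum => s _.
by rewrite lee_fin fg.
Qed.

Lemma abssumZ (k : R) (f : J -> R) : abssum f -> abssum (fun s => k * f s).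
Proof.
move=> fs; rewrite /abssum.
under eq_esum do rewrite normrM.
rewrite esumZl// esum_fin//.
by rewrite -EFinM ltry.
Qed.

Lemma abssumD (f g : J -> R) : abssum f -> abssum g -> abssum (fun s => f s + g s).
Proof.
move=> fs gs.
apply: (@le_lt_trans _ _ (\esum_(s in [set: J]) (`|f s|%:E + `|g s|%:E))%E).
  by apply: le_esum => s _; rewrite -EFinD lee_fin ler_normD.
rewrite esumD; first by rewrite lte_add_pinfty.
- by move=> s _; rewrite lee_fin.
- by move=> s _; rewrite lee_fin.
Qed.

Lemma abssum_pos (f : J -> R) : abssum f ->
  (\esum_(s in [set: J]) (Num.max (f s) 0)%:E < +oo)%E.
Proof.
apply: le_lt_trans; apply: le_esum => s _.
by rewrite lee_fin ge_max ler_norm normr_ge0.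
Qed.

Lemma abssumN (f : J -> R) : abssum f -> abssum (fun s => - f s).
Proof. by apply: abssum_le => s; rewrite normrN. Qed.

Lemma max0_ge0 (x : R) : 0 <= Num.max x 0.
Proof. by rewrite le_max lexx orbT. Qed.

Lemma rsumN (f : J -> R) : rsum (fun s => - f s) = - rsum f.
Proof.
rewrite /rsum opprB; congr (_ - fine _); apply: eq_esum => s _.
by rewrite opprK.
Qed.

(** Positive parts are not additive, but (f + g)^+ + f^- + g^- and
    (f + g)^- + f^+ + g^+ are equal termwise, and every sum is finite. *)
Lemma rsumD (f g : J -> R) : abssum f -> abssum g ->
  rsum (fun s => f s + g s) = rsum f + rsum g.
Proof.
move=> fs gs; rewrite /rsum.
have P h : abssum h -> \esum_(s in [set: J]) (Num.max (h s) 0)%:E =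
   (fine (\esum_(s in [set: J]) (Num.max (h s) 0)%:E))%:E.
  by move=> hs; apply: esum_fin => [s|]; [exact: max0_ge0|exact: abssum_pos].
have e : (\esum_(s in [set: J]) (Num.max (f s + g s) 0)%:E +
          \esum_(s in [set: J]) (Num.max (- f s) 0)%:E +
          \esum_(s in [set: J]) (Num.max (- g s) 0)%:E =
          \esum_(s in [set: J]) (Num.max (- (f s + g s)) 0)%:E +
          \esum_(s in [set: J]) (Num.max (f s) 0)%:E +
          \esum_(s in [set: J]) (Num.max (g s) 0)%:E)%E.
  rewrite -!esumD; try by move=> *; rewrite ?adde_ge0 ?lee_fin ?max0_ge0.
  apply: eq_esum => s _; rewrite -!EFinD; congr EFin.
  have m (x : R) : Num.max (- x) 0 = Num.max x 0 - x.
    by rewrite /Num.max /Order.max; do 2 case: ifP => /=; lra.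
  by rewrite !m; ring.
move: e; rewrite (P _ (abssumD fs gs)) (P _ fs) (P _ gs) (P _ (abssumN fs)) (P _ (abssumN gs)).
rewrite (P _ (abssumN (abssumD fs gs))) -!EFinD => -[e] /=.
lra.
Qed.

Lemma rsum_ge0E (f : J -> R) : (forall s, 0 <= f s) ->
  rsum f = fine (\esum_(s in [set: J]) (f s)%:E).
Proof.
move=> f0; rewrite /rsum [X in _ - fine X]esum1 ?subr0.
  by congr fine; apply: eq_esum => s _; rewrite max_l.
by move=> s _; rewrite max_r// oppr_le0.
Qed.

Lemma rsumZ (k : R) (f : J -> R) : abssum f -> rsum (fun s => k * f s) = k * rsum f.
Proof.
move=> fs.
wlog k0 : k / 0 <= k.
  move=> W; case: (leP 0 k) => [|/ltW k0]; first exact: W.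
  rewrite (_ : (fun s => _) = (fun s => - (- k * f s))); last first.
    by apply: funext => s; rewrite mulNr opprK.
  by rewrite rsumN W ?oppr_ge0// mulNr opprK.
have mx x : Num.max (k * x) 0 = k * Num.max x 0.
  by rewrite maxr_pMr// mulr0.
rewrite /rsum.
under eq_esum do rewrite mx.
under [X in _ - fine X]eq_esum do rewrite -mulrN mx.
rewrite !esumZl//; try by
  [move=> s; exact: max0_ge0|exact: abssum_pos|exact: abssum_pos (abssumN fs)].
rewrite !fineM//; try by rewrite ge0_fin_numE;
  [exact: abssum_pos || exact: abssum_pos (abssumN fs)|
   apply: esum_ge0 => s _; rewrite lee_fin max0_ge0].
by rewrite /= mulrBr.
Qed.

Definition cabssum (f : J -> R[i]) :=
  abssum (fun s => complex.Re (f s)) /\ abssum (fun s => complex.Im (f s)).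

Lemma csum_linear (c : R[i]) (f g : J -> R[i]) : cabssum f -> cabssum g ->
  csum (fun s => c * f s + g s) = c * csum f + csum g.
Proof.
move=> [f0 f1] [g0 g1]; case: c => a b; rewrite /csum.
have eR : (fun s => complex.Re ((a +i* b) * f s + g s)) = (fun s =>
    a * complex.Re (f s) + (- b * complex.Im (f s) + complex.Re (g s))).
  by apply: funext => s; case: (f s) (g s) => [? ?] [? ?] /=; ring.
have eI : (fun s => complex.Im ((a +i* b) * f s + g s)) = (fun s =>
    a * complex.Im (f s) + (b * complex.Re (f s) + complex.Im (g s))).
  by apply: funext => s; case: (f s) (g s) => [? ?] [? ?] /=; ring.
rewrite eR eI.
rewrite (rsumD (abssumZ a f0) (abssumD (abssumZ (- b) f1) g0)).
rewrite (rsumD (abssumZ a f1) (abssumD (abssumZ b f0) g1)).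
rewrite (rsumD (abssumZ (- b) f1) g0) (rsumD (abssumZ b f0) g1).
rewrite (rsumZ a f0) (rsumZ a f1) (rsumZ b f0) (rsumZ (- b) f1).
by apply/eqP; rewrite eq_complex /=; apply/andP; split; apply/eqP; ring.
Qed.

Lemma csum_conj (f : J -> R[i]) : csum (fun s => (f s)^*) = (csum f)^*.
Proof.
apply/eqP; rewrite eq_complex /csum /= -rsumN.
have eR : (fun s => complex.Re (f s)^*) = (fun s => complex.Re (f s)).
  by apply: funext => s; case: (f s).
have eI : (fun s => complex.Im (f s)^*) = (fun s => - complex.Im (f s)).
  by apply: funext => s; case: (f s).
by rewrite eR eI !eqxx.
Qed.

Lemma rsum_single (f : J -> R) (s : J) : (forall t, t != s -> f t = 0) -> rsum f = f s.
Proof.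
move=> fz.
have E (h : J -> R) : (forall t, 0 <= h t) -> (forall t, t != s -> h t = 0) ->
    fine (\esum_(t in [set: J]) (h t)%:E) = h s.
  move=> h0 hz; rewrite (_ : esum _ _ = \esum_(t in [set s]) (h t)%:E).
    by rewrite esum_set1 ?lee_fin.
  rewrite [RHS]esum_mkcond; apply: eq_esum => t _.
  case: (eqVneq t s) => [->|ts]; first by rewrite mem_set.
  by rewrite memNset ?hz//; apply/eqP.
rewrite /rsum (E (fun t => Num.max (f t) 0)) ?(E (fun t => Num.max (- f t) 0)).
- by rewrite /Num.max /Order.max; do 2 case: ifP => /=; lra.
- by move=> t; exact: max0_ge0.
- by move=> t /fz ->; rewrite oppr0 maxxx.
- by move=> t; exact: max0_ge0.
- by move=> t /fz ->; rewrite maxxx.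
Qed.

Lemma csum_single (f : J -> R[i]) (s : J) : (forall t, t != s -> f t = 0) -> csum f = f s.
Proof.
move=> fz; rewrite /csum (rsum_single (s := s)) => [|t /fz -> //].
by rewrite (rsum_single (s := s)) => [|t /fz -> //]; case: (f s).
Qed.

End Sums.

(** * The Hilbert space of square-summable families *)

Arguments inner : simpl never.
Arguments l2norm : simpl never.

Section HilbertSpace.
Context (R : realType) (J : choiceType).
Local Notation H := (l2 R J).
Implicit Types (x y z : H).

Lemma esum_le_fset (f : J -> R) (K : R) :
  (forall F : {fset J}, \sum_(s <- F) f s <= K) ->
  (\esum_(s in [set: J]) (f s)%:E <= K%:E)%E.
Proof.
move=> h; apply: ge_ereal_sup => _ [X [finX XJ] <-].
by rewrite fsbig_finite//= sumEFin lee_fin.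
Qed.

Lemma fset_le_esum (f : J -> R) (F : {fset J}) :
  ((\sum_(s <- F) f s)%:E <= \esum_(s in [set: J]) (f s)%:E)%E.
Proof.
apply: ereal_sup_ubound; exists [set` F]; first by split=> //; exact: finite_fset.
by rewrite fsbig_finite//= ?set_fsetK ?sumEFin//; exact: finite_fset.
Qed.

Lemma cabssum_mul x y : cabssum (fun s => x s * (y s)^*).
Proof.
have b s : normc (x s * (y s)^*) <= `|normc (x s) ^+ 2 + normc (y s) ^+ 2|.
  rewrite normcM normc_conj ger0_norm ?addr_ge0 ?sqr_ge0//.
  have := normc_ge0 (x s); have := normc_ge0 (y s).
  move: (normc (x s)) (normc (y s)) => a c ha hc; nra.
have f z : abssum (fun s => normc (z s) ^+ 2).
  by apply: le_lt_trans (l2P z); apply: le_esum => s _; rewrite ger0_norm ?sqr_ge0.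
split; apply: abssum_le (abssumD (f x) (f y)) => s; apply: le_trans (b s).
  exact: ler_Re_normc.
exact: ler_Im_normc.
Qed.

Lemma inner_linear (c : R[i]) x y z :
  inner (c *: x + y) z = c * inner x z + inner y z.
Proof.
rewrite /inner -csum_linear; [|exact: cabssum_mul|exact: cabssum_mul].
by congr csum; apply: funext => s; rewrite mulrA -mulrDl.
Qed.

Lemma innerC x y : inner y x = (inner x y)^*.
Proof.
rewrite /inner -csum_conj; congr csum; apply: funext => s.
by rewrite conjcM conjCK mulrC.
Qed.

Lemma inner_linear_r (c : R[i]) x y z :
  inner z (c *: x + y) = c^* * inner z x + inner z y.
Proof.
by rewrite innerC inner_linear conjcD conjcM -!innerC. Qed.

Lemma inner0l z : inner 0 z = 0.
Proof. by have := inner_linear (-1) 0 0 z; rewrite scaler0 addr0 mulN1r addNr. Qed.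

Lemma innerDl x y z : inner (x + y) z = inner x z + inner y z.
Proof. by rewrite -[x]scale1r inner_linear mul1r scale1r. Qed.

Lemma innerZl c x z : inner (c *: x) z = c * inner x z.
Proof. by rewrite -[c *: x]addr0 inner_linear inner0l addr0. Qed.

Lemma innerBl x y z : inner (x - y) z = inner x z - inner y z.
Proof. by rewrite addrC -scaleN1r inner_linear mulN1r addrC. Qed.

Lemma innerDr x y z : inner z (x + y) = inner z x + inner z y.
Proof. by rewrite innerC innerDl conjcD -!innerC. Qed.

Lemma innerBr x y z : inner z (x - y) = inner z x - inner z y.
Proof. by rewrite innerC innerBl conjcB -!innerC. Qed.

Lemma inner_selfE x :
  inner x x = (fine (\esum_(s in [set: J]) (normc (x s) ^+ 2)%:E))%:C.
Proof.
rewrite /inner /csum; apply/eqP; rewrite eq_complex /=; apply/andP; split; apply/eqP.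
  rewrite -rsum_ge0E; last by move=> s; exact: sqr_ge0.
  by congr rsum; apply: funext => s; rewrite mulcJ.
rewrite rsum_ge0E => [|s]; last by rewrite mulcJ.
by rewrite esum1// => s _; rewrite mulcJ.
Qed.

Lemma l2norm_ge0 x : 0 <= l2norm x.
Proof. exact: sqrtr_ge0. Qed.

Lemma l2norm_sqr x :
  (l2norm x ^+ 2)%:E = \esum_(s in [set: J]) (normc (x s) ^+ 2)%:E.
Proof.
have e0 : (0 <= \esum_(s in [set: J]) (normc (x s) ^+ 2)%:E)%E.
  by apply: esum_ge0 => s _; rewrite lee_fin sqr_ge0.
rewrite /l2norm inner_selfE /= sqr_sqrtr; last exact: fine_ge0.
by rewrite fineK// ge0_fin_numE//; exact: l2P.
Qed.

Lemma inner_self x : inner x x = (l2norm x ^+ 2)%:C.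
Proof. by rewrite inner_selfE -l2norm_sqr. Qed.

Lemma cauchy_schwarz x y : normc (inner x y) <= l2norm x * l2norm y.
Proof.
have := @sesqui_form_bound R (inner x x) (inner y x) (inner x y) (inner y y).
rewrite !inner_self !lecR !sqr_ge0 => /(_ isT isT)[].
  move=> t; rewrite (_ : _ + _ = inner (x + t *: y) (x + t *: y)).
    by rewrite inner_self lecR sqr_ge0.
  rewrite [x + _]addrC inner_linear !inner_linear_r -!inner_self.
  by ring.
move=> -> h; rewrite normc_conj -ler_sqr ?nnegrE ?normc_ge0 ?mulr_ge0 ?l2norm_ge0//.
by rewrite exprMn.
Qed.

(** Finite partial sums decide the norm; this turns norm estimates for limits into
    finitely many coordinatewise limits. *)
Lemma l2norm_le_fset x (K : R) : 0 <= K ->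
  (forall F : {fset J}, \sum_(s <- F) normc (x s) ^+ 2 <= K ^+ 2) -> l2norm x <= K.
Proof.
move=> K0 h; rewrite -ler_sqr ?nnegrE ?l2norm_ge0// -lee_fin l2norm_sqr.
exact: esum_le_fset.
Qed.

Lemma fset_le_l2norm x (F : {fset J}) : \sum_(s <- F) normc (x s) ^+ 2 <= l2norm x ^+ 2.
Proof. by rewrite -lee_fin l2norm_sqr; exact: (@fset_le_esum (fun s => normc (x s) ^+ 2)). Qed.

Lemma coord_le_l2norm x s : normc (x s) <= l2norm x.
Proof.
rewrite -ler_sqr ?nnegrE ?normc_ge0 ?l2norm_ge0//.
by have := fset_le_l2norm x [fset s]%fset; rewrite big_seq_fset1.
Qed.

Lemma l2norm0 : l2norm (0 : H) = 0.
Proof. by rewrite /l2norm inner0l sqrtr0. Qed.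

Lemma l2normZ c x : l2norm (c *: x) = normc c * l2norm x.
Proof.
apply/eqP; rewrite -(@eqrXn2 _ 2) ?l2norm_ge0 ?mulr_ge0 ?normc_ge0 ?l2norm_ge0//; apply/eqP.
have := inner_self (c *: x).
rewrite innerZl [inner x _]innerC innerZl conjcM -innerC mulrA mulcJ inner_self.
by move=> /(congr1 (@complex.Re R)) /=; rewrite mulr0 subr0 exprMn.
Qed.

Lemma l2normN x : l2norm (- x) = l2norm x.
Proof. by rewrite -scaleN1r l2normZ normcN normc1 mul1r. Qed.

Lemma l2normD x y : l2norm (x + y) <= l2norm x + l2norm y.
Proof.
rewrite -ler_sqr ?nnegrE ?addr_ge0 ?l2norm_ge0//.
have e : l2norm (x + y) ^+ 2 = l2norm x ^+ 2 + l2norm y ^+ 2 + complex.Re (inner x y) *+ 2.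
  have := inner_self (x + y); rewrite innerDl !innerDr [inner y x]innerC !inner_self.
  by move=> /(congr1 (@complex.Re R)); case: (inner x y) => a b /= <-; ring.
have h : complex.Re (inner x y) <= l2norm x * l2norm y.
  apply: le_trans (ler_norm _) _; apply: le_trans (ler_Re_normc _) _.
  exact: cauchy_schwarz.
rewrite e sqrrD; lra.
Qed.

Lemma l2normB x y : l2norm (x - y) <= l2norm x + l2norm y.
Proof. by rewrite (le_trans (l2normD _ _))// l2normN. Qed.

Lemma l2norm_eq0 x : l2norm x <= 0 -> x = 0.
Proof.
move=> h; apply/val_inj/funext => s; apply: eq0_normc; apply/le_anti.
by rewrite normc_ge0 andbT (le_trans (coord_le_l2norm x s)).
Qed.

End HilbertSpace.

(** * Completeness *)

Section Completeness.
Context (R : realType).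

(** All the u n - e n are below all the u m + e m, so the supremum of the former is a
    limit with the stated rate. *)
Lemma real_cauchy_limit (u e : nat -> R) :
  (forall n m, (n <= m)%N -> `|u m - u n| <= e n) ->
  exists l, forall n, `|l - u n| <= e n.
Proof.
move=> c; pose S := [set u n - e n | n in [set: nat]].
have ub m : ubound S (u m + e m).
  move=> _ [n _ <-]; case: (leqP n m) => [nm|/ltnW nm].
    have := c _ _ nm; rewrite ler_norml => /andP[h _].
    have := le_trans (normr_ge0 _) (c m m (leqnn _)); lra.
  have := c _ _ nm; rewrite ler_norml => /andP[_ h].
  have := le_trans (normr_ge0 _) (c n n (leqnn _)); lra.
have hs : has_sup S by split; [exists (u 0 - e 0), 0|exists (u 0 + e 0); exact: ub].
exists (sup S) => n; rewrite ler_norml; apply/andP; split.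
  by rewrite lerBrDr addrC; apply: ub_le_sup; [case: hs|exists n].
by rewrite lerBlDl; apply: ge_sup; [case: hs|exact: ub].
Qed.

Lemma half_expr_ge0 n : 0 <= (2^-1 : R) ^+ n.
Proof. by rewrite exprn_ge0// invr_ge0. Qed.

Lemma half_expr_le1 n : (2^-1 : R) ^+ n <= 1.
Proof. by rewrite exprn_ile1// ?invr_ge0// invf_le1// ler1n. Qed.

Lemma half_expr_anti n m : (n <= m)%N -> (2^-1 : R) ^+ m <= 2^-1 ^+ n.
Proof.
move=> nm; rewrite -(subnKC nm) exprD.
by rewrite ler_piMr ?half_expr_ge0 ?half_expr_le1.
Qed.

(** The rate 2^-n is used for every approximation below, which lets all limits be
    taken along plain sequences with an explicit modulus. *)
Lemma geometric_le0 (a K : R) : (forall n, a <= K * 2^-1 ^+ n) -> a <= 0.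
Proof.
move=> h; rewrite leNgt; apply/negP => a0.
have K0 : 0 < K by have := h 0; rewrite expr0 mulr1; apply: lt_le_trans.
have [N hN] : exists N : nat, K / a < N%:R.
  by exists (Num.bound (K / a)); rewrite archi_boundP ?divr_ge0 ?ltW.
have := h N; rewrite exprVn ler_pdivlMr ?exprn_gt0// leNgt => /negP; apply.
rewrite mulrC -ltr_pdivrMr//; apply: lt_le_trans hN _.
by rewrite -natrX ler_nat ltnW// ltn_expl.
Qed.

Lemma geometric_eq0 (a K : R) : 0 <= a -> (forall n, a <= K * 2^-1 ^+ n) -> a = 0.
Proof. by move=> a0 /geometric_le0 h; apply/le_anti; rewrite h. Qed.

Lemma complex_cauchy_limit (u : nat -> R[i]) (e : nat -> R) :
  (forall n m, (n <= m)%N -> normc (u m - u n) <= e n) ->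
  exists l, forall n, normc (l - u n) <= 2 * e n.
Proof.
move=> c.
have [a ha] : exists a, forall n, `|a - complex.Re (u n)| <= e n.
  apply: real_cauchy_limit => n m /c; apply: le_trans.
  by apply: le_trans (ler_Re_normc _); rewrite raddfB.
have [b hb] : exists b, forall n, `|b - complex.Im (u n)| <= e n.
  apply: real_cauchy_limit => n m /c; apply: le_trans.
  by apply: le_trans (ler_Im_normc _); rewrite raddfB.
exists (a +i* b) => n; apply: le_trans (ler_normc_ReIm _) _.
rewrite !raddfB /= mulrDl mul1r lerD//.
Qed.

(** The limit is taken coordinatewise; a bound on finite partial sums passes to the
    limit, so the limit is square-summable and is approached at the same rate. *)
Lemma l2_cauchy_limit (J : choiceType) (u : nat -> l2 R J) (K : R) :
  (forall n m, (n <= m)%N -> l2norm (u m - u n) <= K * 2^-1 ^+ n) ->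
  exists x, forall n, l2norm (x - u n) <= K * 2^-1 ^+ n.
Proof.
move=> c.
have p0 := half_expr_ge0.
have K0 : 0 <= K.
  by have := c 0 0 (leqnn _); rewrite expr0 mulr1; apply: le_trans; exact: l2norm_ge0.
have /choice [z hz] s : exists l, forall n, normc (l - u n s) <= 2 * (K * 2^-1 ^+ n).
  apply: complex_cauchy_limit => n m nm.
  exact: le_trans (coord_le_l2norm (u m - u n) s) (c _ _ nm).
have fin n (F : {fset J}) :
    \sum_(s <- F) normc (z s - u n s) ^+ 2 <= (K * 2^-1 ^+ n) ^+ 2.
  set E := K * _; have E0 : 0 <= E by rewrite mulr_ge0.
  rewrite -subr_le0.
  apply: (@geometric_le0 _ (\sum_(s <- F) (2 * E + 2 * K) * (2 * K))) => k.
  rewrite lerBlDl.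
  apply: (@le_trans _ _ (\sum_(s <- F) (normc (u (n + k)%N s - u n s) ^+ 2 +
      (2 * E + 2 * K) * (2 * K) * 2^-1 ^+ k))).
    apply: ler_sum => s _.
    set a := normc (u (n + k)%N s - u n s).
    set d := 2 * K * 2^-1 ^+ k.
    have d0 : 0 <= d by rewrite !mulr_ge0.
    have p1 := half_expr_le1.
    have dK : d <= 2 * K by rewrite ler_piMr ?p1// mulr_ge0.
    have aE : a <= E.
      exact: le_trans (coord_le_l2norm (u (n + k)%N - u n) s) (c _ _ (leq_addr _ _)).
    have bd : normc (z s - u (n + k)%N s) <= d.
      apply: le_trans (hz s _) _; rewrite /d mulrA ler_wpM2l ?mulr_ge0//.
      by rewrite exprD ler_piMl ?p1.
    have tri : normc (z s - u n s) <= a + d.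
      rewrite -(subrK (u (n + k)%N s) (z s)) -addrA.
      apply: le_trans (le_normcD _ _) _; rewrite [a + d]addrC; exact: lerD.
    have a0 : 0 <= a by exact: normc_ge0.
    have := normc_ge0 (z s - u n s); move: tri; move: (normc _) => b tri b0.
    rewrite -mulrA -/d; nra.
  rewrite big_split /= lerD//; last by rewrite mulr_suml.
  apply: le_trans (fset_le_l2norm (u (n + k)%N - u n) F) _.
  by rewrite ler_sqr ?nnegrE ?l2norm_ge0//; apply: c; exact: leq_addr.
have sz : (fun s => z s - u 0%N s) \in @sqsummable R J.
  rewrite inE /=; apply: le_lt_trans (ltry ((K * 2^-1 ^+ 0) ^+ 2)).
  exact: esum_le_fset (fin 0%N).
pose x : l2 R J := u 0%N + L2 sz.
have xE s : x s = z s by rewrite -[x s]/(u 0%N s + (z s - u 0%N s)) addrC subrK.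
exists x => n; apply: l2norm_le_fset => [|F]; first by rewrite mulr_ge0.
apply: le_trans (fin n F); rewrite le_eqVlt; apply/orP; left; apply/eqP.
by apply: eq_bigr => s _; rewrite -xE.
Qed.

End Completeness.

(** * Bounded operators and adjoints *)

Section BoundedOperators.
Context (R : realType) (J : choiceType).
Local Notation H := (l2 R J).
Local Notation op := (H -> H).
Implicit Types (x y : H) (A B : op) (K L : R).

(** A real bound in place of the extended-real opnorm; the two agree by
    bounded_opP and norm_closureP. *)
Definition bounded_by A K := linear A /\ forall x, l2norm (A x) <= K * l2norm x.

Lemma linear_op0 A : linear A -> A 0 = 0.
Proof. by move=> lA; have := lA (-1) 0 0; rewrite scaler0 addr0 scaleN1r addNr. Qed.

Lemma linear_opZ A : linear A -> forall c x, A (c *: x) = c *: A x.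
Proof. by move=> lA c x; rewrite -[c *: x]addr0 lA linear_op0// addr0. Qed.

Lemma linear_opB A : linear A -> forall x y, A (x - y) = A x - A y.
Proof. by move=> lA x y; rewrite addrC -scaleN1r lA scaleN1r addrC. Qed.

Lemma linear_op_comb c A B : linear A -> linear B -> linear (c *: A + B).
Proof.
move=> lA lB k x y; rewrite -![(c *: A + B) _]/(c *: A _ + B _) lA lB.
by rewrite !scalerDr !scalerA [c * k]mulrC !addrA; congr (_ + _); rewrite addrAC.
Qed.

Lemma linear_op_comp A B : linear A -> linear B -> linear (A \o B).
Proof. by move=> lA lB k x y; rewrite /= lB lA. Qed.

Lemma bounded_by_le A K L : K <= L -> bounded_by A K -> bounded_by A L.
Proof.
move=> KL [lA h]; split=> // x; apply: le_trans (h x) _.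
by rewrite ler_wpM2r// l2norm_ge0.
Qed.

Lemma bounded_by_pos A K : bounded_by A K -> exists2 L, 0 < L & bounded_by A L.
Proof.
move=> h; exists (`|K| + 1); first by rewrite ltr_wpDl.
by apply: bounded_by_le h; rewrite (le_trans (ler_norm K))// lerDl.
Qed.

Lemma bounded_by_id : bounded_by id 1.
Proof. by split=> [c x y|x] //; rewrite mul1r. Qed.

Lemma bounded_by_comb c A B K L : bounded_by A K -> bounded_by B L ->
  bounded_by (c *: A + B) (normc c * K + L).
Proof.
move=> [lA hA] [lB hB]; split; first exact: linear_op_comb.
move=> x; rewrite -[(c *: A + B) _]/(c *: A _ + B _).
apply: le_trans (l2normD _ _) _; rewrite l2normZ mulrDl lerD//.
by rewrite -mulrA ler_wpM2l ?normc_ge0.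
Qed.

Lemma bounded_byD A B K L : bounded_by A K -> bounded_by B L -> bounded_by (A + B) (K + L).
Proof.
by move=> hA hB; have := bounded_by_comb 1 hA hB; rewrite scale1r normc1 mul1r.
Qed.

Lemma bounded_byB A B K L : bounded_by A K -> bounded_by B L -> bounded_by (A - B) (K + L).
Proof.
move=> hA hB; have := bounded_by_comb (-1) hB hA.
by rewrite scaleN1r normcN normc1 mul1r addrC [L + K]addrC.
Qed.

Lemma bounded_by_comp A B K L : 0 <= K -> bounded_by A K -> bounded_by B L ->
  bounded_by (A \o B) (K * L).
Proof.
move=> K0 [lA hA] [lB hB]; split; first exact: linear_op_comp.
by move=> x; apply: le_trans (hA _) _; rewrite -mulrA ler_wpM2l.
Qed.

Lemma opnorm_le A K : 0 <= K -> bounded_by A K -> (opnorm A <= K%:E)%E.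
Proof.
move=> K0 [lA h]; apply: ge_ereal_sup => _ [x /= x1 <-]; rewrite lee_fin.
by apply: le_trans (h x) _; rewrite ler_piMr.
Qed.

Lemma bounded_by_opnorm A K : linear A -> (opnorm A <= K%:E)%E -> bounded_by A K.
Proof.
move=> lA h; split=> // x.
have [x0|x0] := leP (l2norm x) 0.
  by rewrite (l2norm_eq0 x0) linear_op0// l2norm0 mulr0.
pose y := ((l2norm x)^-1)%:C *: x.
have y1 : l2norm y = 1.
  by rewrite l2normZ normc_real gtr0_norm ?invr_gt0// mulVf// gt_eqF.
have : ((l2norm (A y))%:E <= opnorm A)%E.
  by apply: ereal_sup_ubound; exists y => //=; rewrite y1.
move=> /le_trans /(_ h); rewrite lee_fin /y linear_opZ// l2normZ normc_real.
by rewrite gtr0_norm ?invr_gt0// ler_pdivrMl// mulrC.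
Qed.

Lemma bounded_opP A : bounded_op A <-> exists K, bounded_by A K.
Proof.
split=> [[lA h]|[K hK]].
  exists (fine (opnorm A)); apply: bounded_by_opnorm => //.
  rewrite fineK// fin_numElt h andbT; apply: (@lt_le_trans _ _ 0%E) => //.
  apply: ereal_sup_ubound; exists 0; rewrite /= ?l2norm0//.
  by rewrite linear_op0// l2norm0.
have [L L0 hL] := bounded_by_pos hK.
by split; [case: hL|apply: le_lt_trans (opnorm_le (ltW L0) hL) (ltry _)].
Qed.

Lemma norm_closureP (S : set op) A : (forall B, S B -> linear B) ->
  norm_closure S A <-> (exists K, bounded_by A K) /\
    forall e : R, 0 < e -> exists2 B, S B & bounded_by (A - B) e.
Proof.
move=> Sl; split=> [[/bounded_opP bA h]|[bA h]]; split=> //.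
- move=> e /h [B SB AB]; exists B => //; apply: bounded_by_opnorm; last exact: ltW.
  have lB := Sl _ SB; case: bA => K [lA _].
  by rewrite addrC -scaleN1r; exact: linear_op_comb.
- exact/bounded_opP.
- move=> e e0; have e2 : 0 < e / 2 by rewrite divr_gt0.
  have [B SB AB] := h _ e2; exists B => //.
  by apply: le_lt_trans (opnorm_le (ltW e2) AB) _; rewrite lte_fin; lra.
Qed.

Lemma adjoint_sym A B : is_adjoint A B -> is_adjoint B A.
Proof. by move=> h x y; rewrite innerC -h -innerC. Qed.

Lemma adjoint_id : is_adjoint (id : op) id.
Proof. by []. Qed.

Lemma adjoint_comb c A A' B B' : is_adjoint A A' -> is_adjoint B B' ->
  is_adjoint (c *: A + B) (c^* *: A' + B').
Proof.
move=> hA hB x y.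
rewrite -[(c *: A + B) x]/(c *: A x + B x) -[(_ + B') y]/(c^* *: A' y + B' y).
by rewrite inner_linear inner_linear_r conjCK hA hB.
Qed.

Lemma adjoint_comp A A' B B' : is_adjoint A A' -> is_adjoint B B' ->
  is_adjoint (A \o B) (B' \o A').
Proof. by move=> hA hB x y; rewrite /= hA hB. Qed.

Lemma inner_inj x y : (forall z, inner z x = inner z y) -> x = y.
Proof.
move=> h; apply/eqP; rewrite -subr_eq0; apply/eqP; apply: l2norm_eq0.
have := inner_self (x - y); rewrite [inner _ (_ - _)]innerBr !h subrr.
move=> /(congr1 (@complex.Re R)) /= /esym/eqP; rewrite sqrf_eq0 => /eqP ->.
by [].
Qed.

Lemma adjoint_unique A B B' : is_adjoint A B -> is_adjoint A B' -> B = B'.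
Proof. by move=> h h'; apply: funext => y; apply: inner_inj => x; rewrite -h -h'. Qed.

(** An adjoint is linear because the inner product separates vectors, and
    |B y|^2 = <A B y, y> <= K |B y| |y|. *)
Lemma adjoint_bounded A B K : bounded_by A K -> is_adjoint A B -> bounded_by B K.
Proof.
move=> [lA bA] h; split.
  move=> c x y; apply: inner_inj => z.
  by rewrite -h !inner_linear_r !h.
move=> y; have [z|z] := leP (l2norm (B y)) 0.
  rewrite (l2norm_eq0 z) l2norm0.
  have := le_trans (l2norm_ge0 _) (bA y).
  by [].
have : l2norm (B y) ^+ 2 <= l2norm (B y) * (K * l2norm y).
  rewrite -[l2norm (B y) ^+ 2]ger0_norm ?sqr_ge0// -normc_real -inner_self -h.
  apply: le_trans (cauchy_schwarz _ _) _.
  by rewrite mulrCA mulrA ler_wpM2r ?l2norm_ge0.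
by rewrite expr2 ler_pM2l.
Qed.

Lemma adjoint_limit A B (An Bn : nat -> op) K :
  (forall n, is_adjoint (An n) (Bn n)) ->
  (forall n, bounded_by (A - An n) (K * 2^-1 ^+ n)) ->
  (forall n, bounded_by (B - Bn n) (K * 2^-1 ^+ n)) -> is_adjoint A B.
Proof.
move=> h hA hB x y; apply/eqP; rewrite -subr_eq0; apply/eqP/eq0_normc.
apply: (@geometric_eq0 _ _ (2 * K * (l2norm x * l2norm y))); first exact: normc_ge0.
move=> n.
have -> : inner (A x) y - inner x (B y) =
   inner ((A - An n) x) y - inner x ((B - Bn n) y).
  rewrite -[(A - An n) x]/(A x - An n x) -[(B - Bn n) y]/(B y - Bn n y).
  by rewrite innerBl innerBr h; ring.
have [_ /(_ x) h1] := hA n; have [_ /(_ y) h2] := hB n.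
apply: le_trans (le_normcD _ _) _; rewrite normcN.
apply: le_trans (lerD (cauchy_schwarz _ _) (cauchy_schwarz _ _)) _.
have := ler_wpM2r (l2norm_ge0 y) h1; have := ler_wpM2l (l2norm_ge0 x) h2.
lra.
Qed.

(** The pointwise limit is linear as its defect of linearity is the limit of
    zeros. *)
Lemma op_cauchy_limit (An : nat -> op) K :
  (forall n m, (n <= m)%N -> bounded_by (An m - An n) (K * 2^-1 ^+ n)) ->
  (forall n, linear (An n)) ->
  exists A, forall n, bounded_by (A - An n) (K * 2^-1 ^+ n).
Proof.
move=> c lin.
have /choice [A hA] x : exists y, forall n,
    l2norm (y - An n x) <= K * l2norm x * 2^-1 ^+ n.
  apply: l2_cauchy_limit => n m /c [_ /(_ x)]; rewrite mulrAC.
  exact.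
have lA : linear A.
  move=> k x y; apply/eqP; rewrite -subr_eq0; apply/eqP/l2norm_eq0.
  apply: (@geometric_le0 _ _ (K * l2norm (k *: x + y) +
    (normc k * (K * l2norm x) + K * l2norm y))) => n.
  have -> : A (k *: x + y) - (k *: A x + A y) =
      (A (k *: x + y) - An n (k *: x + y)) -
      (k *: (A x - An n x) + (A y - An n y)).
    by rewrite (lin n k x y) scalerBr addrACA -opprD opprB addrA subrK.
  apply: le_trans (l2normB _ _) _; rewrite [leRHS]mulrDl.
  apply: lerD; first exact: hA.
  apply: le_trans (l2normD _ _) _; rewrite [leRHS]mulrDl.
  apply: lerD; last exact: hA.
  by rewrite l2normZ -mulrA; apply: ler_wpM2l; [exact: normc_ge0|exact: hA].
exists A => n; split.
  by rewrite addrC -scaleN1r; exact: linear_op_comb.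
by move=> x; rewrite mulrAC; exact: hA.
Qed.

End BoundedOperators.

(** * The norm closure of a star-algebra of operators *)

Section CstarAlgebra.
Context (R : realType) (J : choiceType).
Local Notation H := (l2 R J).
Local Notation op := (H -> H).
Context (G : set op).
Context (G_adjointable :
  forall A, G A -> (exists K, bounded_by A K) /\ exists B, is_adjoint A B).
Local Notation S := (star_alg G).
Local Notation M := (norm_closure (star_alg G)).
Implicit Types (x y : H) (A B T Y : op) (K L : R).

Lemma star_alg_bounded A : S A -> exists K, bounded_by A K.
Proof.
elim=> {A} [A /G_adjointable[]//||c A B _ [K hA] _ [L hB]|A B _ [K hA] _ [L hB]|A B _ [K hA] AB].
- by exists 1; exact: bounded_by_id.
- by exists (normc c * K + L); exact: bounded_by_comb.
- have [K' K0 hA'] := bounded_by_pos hA.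
  by exists (K' * L); apply: bounded_by_comp => //; exact: ltW.
- by exists K; exact: adjoint_bounded hA AB.
Qed.

Lemma star_alg_linear A : S A -> linear A.
Proof. by move=> /star_alg_bounded[K []]. Qed.

(** The set of operators with an adjoint is itself stable under the constructors of
    star_alg; adjoints are again in the algebra by definition. *)
Lemma star_alg_adjoint A : S A -> exists2 B, S B & is_adjoint A B.
Proof.
move=> SA; suff [B AB] : exists B, is_adjoint A B.
  by exists B => //; exact: star_alg_adj SA AB.
elim: SA => {A} [A /G_adjointable[]//||c A B _ [A' hA] _ [B' hB]|
  A B _ [A' hA] _ [B' hB]|A B _ _ AB].
- by exists id; exact: adjoint_id.
- by exists (c^* *: A' + B'); exact: adjoint_comb.
- by exists (B' \o A'); exact: adjoint_comp.
- by exists A; exact: adjoint_sym.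
Qed.

Lemma cstarP A : M A <-> (exists K, bounded_by A K) /\
  forall e : R, 0 < e -> exists2 B, S B & bounded_by (A - B) e.
Proof. exact/norm_closureP/star_alg_linear. Qed.

Lemma cstar_bounded A : M A -> exists K, bounded_by A K.
Proof. by move=> /cstarP[]. Qed.

Lemma cstar_linear A : M A -> linear A.
Proof. by move=> /cstar_bounded[K []]. Qed.

Lemma star_alg_cstar A : S A -> M A.
Proof.
move=> SA; apply/cstarP; split=> [|e e0]; first exact: star_alg_bounded.
exists A => //; split=> [c x y|x].
  by rewrite subrr /= scaler0 addr0.
by rewrite subrr l2norm0 mulr_ge0 ?l2norm_ge0// ltW.
Qed.

Lemma cstar_id : M id.
Proof. by apply: star_alg_cstar; exact: star_alg_id. Qed.

Lemma cstar_comb c A B : M A -> M B -> M (c *: A + B).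
Proof.
move=> /cstarP[[K hA] cA] /cstarP[[L hB] cB]; apply/cstarP; split.
  by exists (normc c * K + L); exact: bounded_by_comb.
move=> e e0; have c1 : 0 < normc c + 1 by rewrite ltr_wpDl ?normc_ge0.
have [A' SA' hA'] := cA _ (divr_gt0 e0 c1).
have [B' SB' hB'] := cB _ (divr_gt0 e0 c1).
exists (c *: A' + B'); first exact: star_alg_lin.
have -> : c *: A + B - (c *: A' + B') = c *: (A - A') + (B - B').
  by rewrite scalerBr opprD addrACA.
apply: bounded_by_le (bounded_by_comb c hA' hB').
by rewrite -{2}[e / _]mul1r -mulrDl mulrC divfK// gt_eqF.
Qed.

Lemma cstarD A B : M A -> M B -> M (A + B).
Proof. by move=> hA hB; rewrite -[A]scale1r; exact: cstar_comb. Qed.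

Lemma cstarB A B : M A -> M B -> M (A - B).
Proof. by move=> hA hB; rewrite addrC -scaleN1r; exact: cstar_comb. Qed.

Lemma cstarZ c A : M A -> M (c *: A).
Proof.
move=> hA; have := cstar_comb c hA (cstarB hA hA).
by rewrite subrr addr0.
Qed.

(** A B - A' B' = A (B - B') + (A - A') B'. *)
Lemma cstar_comp A B : M A -> M B -> M (A \o B).
Proof.
move=> /cstarP[[K0 hA0] cA] /cstarP[[L0 hB0] cB]; apply/cstarP.
have [K Kp hA] := bounded_by_pos hA0; have [L Lp hB] := bounded_by_pos hB0.
split; first by exists (K * L); apply: bounded_by_comp => //; exact: ltW.
move=> e e0; have d0 : 0 < e / 2 / K by rewrite !divr_gt0.
have [B' SB' hB'] := cB _ d0.
have L'p : 0 < L + e / 2 / K by rewrite addr_gt0.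
have f0 : 0 < e / 2 / (L + e / 2 / K) by rewrite !divr_gt0.
have [A' SA' hA'] := cA _ f0.
exists (A' \o B'); first exact: star_alg_comp.
have -> : (A \o B) - (A' \o B') = (A \o (B - B')) + ((A - A') \o B').
  apply: funext => x; rewrite -[LHS]/(A (B x) - A' (B' x)).
  rewrite -[RHS]/(A (B x - B' x) + (A (B' x) - A' (B' x))).
  have [lA _] := hA; by rewrite (linear_opB lA) addrA subrK.
have bB' : bounded_by B' (L + e / 2 / K).
  by have := bounded_byB hB hB'; rewrite opprB addrC subrK.
apply: bounded_by_le (bounded_byD (bounded_by_comp (ltW Kp) hA hB')
  (bounded_by_comp (ltW f0) hA' bB')).
rewrite mulrC divfK ?gt_eqF// divfK ?gt_eqF//; lra.
Qed.

Lemma cstar_seq A : M A -> exists An : nat -> op,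
  forall n, S (An n) /\ bounded_by (A - An n) (2^-1 ^+ n).
Proof.
move=> /cstarP[_ cA].
have /choice [An h] n : exists B, S B /\ bounded_by (A - B) (2^-1 ^+ n).
  have [|B SB hB] := cA (2^-1 ^+ n); first by rewrite exprn_gt0// invr_gt0.
  by exists B.
by exists An.
Qed.

Lemma cstar_limit A (An : nat -> op) K : (forall n, M (An n)) ->
  (forall n, bounded_by (A - An n) (K * 2^-1 ^+ n)) -> M A.
Proof.
move=> MAn h; apply/cstarP; split.
  have [L hL] := cstar_bounded (MAn 0%N).
  by exists (K * 2^-1 ^+ 0 + L); have := bounded_byD (h 0%N) hL; rewrite subrK.
move=> e e0.
have [n hn] : exists n, K * 2^-1 ^+ n <= e / 2.
  apply: contrapT => /forallNP no.
  have : e / 2 <= 0.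
    apply: (@geometric_le0 _ _ K) => n; rewrite ltW// ltNge; exact/negP/no.
  by rewrite leNgt divr_gt0.
have e2 : 0 < e / 2 by rewrite divr_gt0.
have [B SB hB] := ((cstarP _).1 (MAn n)).2 _ e2.
exists B => //; have := bounded_byD (h n) hB; rewrite addrA subrK.
apply: bounded_by_le; lra.
Qed.

(** Adjunction preserves bounds, so the adjoints of approximations of A form a Cauchy
    sequence; its limit is the adjoint of A. *)
Lemma cstar_adjoint A : M A -> exists2 B, M B & is_adjoint A B.
Proof.
move=> MA; have [An hAn] := cstar_seq MA.
have /choice [Bn hBn] n : exists B, S B /\ is_adjoint (An n) B.
  by have [B SB AB] := star_alg_adjoint (hAn n).1; exists B.
have cauchy n m : (n <= m)%N -> bounded_by (Bn m - Bn n) (2 * 2^-1 ^+ n).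
  move=> nm; apply: (@adjoint_bounded _ _ (An m - An n)).
    have := bounded_byB (hAn n).2 (hAn m).2.
    rewrite opprB addrC addrA subrK; apply: bounded_by_le.
    by rewrite mulr_natl mulr2n lerD2l; exact: half_expr_anti.
  have := adjoint_comb (-1) (hBn n).2 (hBn m).2.
  by rewrite rmorphN rmorph1 !scaleN1r [- An n + _]addrC [- Bn n + _]addrC.
have [B hB] := op_cauchy_limit cauchy (fun n => star_alg_linear (hBn n).1).
exists B; first exact: cstar_limit (fun n => star_alg_cstar (hBn n).1) hB.
apply: (@adjoint_limit _ _ _ _ An Bn 2) => // n; first exact: (hBn n).2.
apply: bounded_by_le (hAn n).2.
by rewrite ler_peMl ?half_expr_ge0// ler1n.
Qed.

(** The iteration for the fixed point 2 Y = T + Y^2, whose solution satisfies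
    (1 - Y)^2 = 1 - T. *)
Fixpoint sqrt_iter T (n : nat) : op :=
  if n is k.+1 then (2^-1 : R)%:C *: (T + (sqrt_iter T k \o sqrt_iter T k))
  else T - T.

Section SquareRoot.
Context (T : op).
Context (MT : M T) (T_sa : is_adjoint T T) (T_small : bounded_by T (2^-1 ^+ 2)).
Local Notation Yn := (sqrt_iter T).

Lemma sqrt_iter_cstar n : M (Yn n).
Proof.
elim: n => [|n IH] /=; first exact: cstarB.
by apply: cstarZ; apply: cstarD; [exact: MT|exact: cstar_comp].
Qed.

Lemma adjointZ (a : R) A B : is_adjoint A B -> is_adjoint (a%:C *: A) (a%:C *: B).
Proof.
move=> h x y; rewrite -[(a%:C *: A) x]/(a%:C *: A x) -[(a%:C *: B) y]/(a%:C *: B y).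
rewrite innerZl h [inner x (_ *: _)]innerC innerZl conjcM -innerC; congr (_ * _).
by apply/eqP; rewrite eq_complex /= oppr0 !eqxx.
Qed.

Lemma adjointD A A' B B' : is_adjoint A A' -> is_adjoint B B' -> is_adjoint (A + B) (A' + B').
Proof. by move=> hA hB; have := adjoint_comb 1 hA hB; rewrite rmorph1 !scale1r. Qed.

Lemma adjointB A A' B B' : is_adjoint A A' -> is_adjoint B B' -> is_adjoint (A - B) (A' - B').
Proof.
move=> hA hB; have := adjoint_comb (-1) hB hA.
by rewrite rmorphN rmorph1 !scaleN1r [- B + _]addrC [- B' + _]addrC.
Qed.

Lemma sqrt_iter_adjoint n : is_adjoint (Yn n) (Yn n).
Proof.
elim: n => [|n IH] /=; first exact: adjointB.
by apply: adjointZ; apply: adjointD; [exact: T_sa|exact: adjoint_comp].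
Qed.

Lemma bounded_byZ (a : R) A K : 0 <= a -> bounded_by A K -> bounded_by (a%:C *: A) (a * K).
Proof.
move=> a0 h; have := bounded_by_comb a%:C h (bounded_byB h h); rewrite subrr addr0 => -[l b].
split=> // x; rewrite -[(a%:C *: A) x]/(a%:C *: A x) l2normZ normc_real ger0_norm//.
by rewrite -mulrA ler_wpM2l//; case: h.
Qed.

Lemma sqrt_iter_bounded n : bounded_by (Yn n) (2^-1 ^+ 2).
Proof.
elim: n => [|n IH] /=.
  split=> [c x y|x]; rewrite subrr ?scaler0 ?addr0//.
  by rewrite l2norm0 mulr_ge0 ?l2norm_ge0 ?exprn_ge0 ?invr_ge0.
have i2 : 0 <= (2^-1 : R) by rewrite invr_ge0.
have q : 0 <= (2^-1 : R) ^+ 2 by rewrite exprn_ge0.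
apply: bounded_by_le (bounded_byZ i2 (bounded_byD T_small (bounded_by_comp q IH IH))).
lra.
Qed.

(** Y^2 - Z^2 = Y (Y - Z) + (Y - Z) Z. *)
Lemma bounded_by_sqrB Y Z K L : 0 <= K -> 0 <= L -> bounded_by Y K -> bounded_by Z K ->
  bounded_by (Y - Z) L -> bounded_by ((Y \o Y) - (Z \o Z)) (2 * K * L).
Proof.
move=> K0 L0 hY hZ hYZ.
have -> : (Y \o Y) - (Z \o Z) = (Y \o (Y - Z)) + ((Y - Z) \o Z).
  apply: funext => x; rewrite -[LHS]/(Y (Y x) - Z (Z x)).
  rewrite -[RHS]/(Y (Y x - Z x) + (Y (Z x) - Z (Z x))).
  have [lY _] := hY; by rewrite (linear_opB lY) addrA subrK.
apply: bounded_by_le (bounded_byD (bounded_by_comp K0 hY hYZ) (bounded_by_comp L0 hYZ hZ)).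
lra.
Qed.

(** On operators of norm at most 1/4 the iteration contracts by the factor 1/4, which is
    better than the rate 2^-n asserted here. *)
Lemma sqrt_iter_cauchy n m : (n <= m)%N -> bounded_by (Yn m - Yn n) (1 * 2^-1 ^+ n).
Proof.
have i2 : 0 <= (2^-1 : R) by rewrite invr_ge0.
have q : 0 <= (2^-1 : R) ^+ 2 by rewrite exprn_ge0.
rewrite mul1r; elim: n m => [|n IH] m.
  move=> _; apply: bounded_by_le (bounded_byB (sqrt_iter_bounded m) (sqrt_iter_bounded 0)).
  rewrite expr0; lra.
case: m => // m nm /=.
have -> : (2^-1 : R)%:C *: (T + (Yn m \o Yn m)) - (2^-1 : R)%:C *: (T + (Yn n \o Yn n)) =
    (2^-1 : R)%:C *: ((Yn m \o Yn m) - (Yn n \o Yn n)).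
  by rewrite -scalerBr opprD addrACA subrr add0r.
have e0 : 0 <= (2^-1 : R) ^+ n by rewrite exprn_ge0.
apply: bounded_by_le (bounded_byZ i2
  (bounded_by_sqrB q e0 (sqrt_iter_bounded m) (sqrt_iter_bounded n) (IH _ nm))).
rewrite [leRHS]exprS; move: e0; move: (2^-1 ^+ n) => e e0; lra.
Qed.

Lemma sqrt_exists : exists Y, [/\ M Y, is_adjoint Y Y & (id - Y) \o (id - Y) = id - T].
Proof.
have [Y hY] := op_cauchy_limit sqrt_iter_cauchy (fun n => cstar_linear (sqrt_iter_cstar n)).
have MY : M Y := cstar_limit sqrt_iter_cstar hY.
exists Y; split=> //; first exact: (adjoint_limit sqrt_iter_adjoint hY hY).
have [K [K0 K1 bY]] : exists K, [/\ 0 <= K, 2^-1 ^+ 2 <= K & bounded_by Y K].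
  have [K0 /bounded_by_pos[L L0 hL]] := cstar_bounded MY.
  exists (L + 1); split; last by apply: bounded_by_le hL; rewrite lerDl.
    by rewrite addr_ge0 ?ltW.
  lra.
have eq2 : Y + Y = T + (Y \o Y).
  apply: funext => x; apply/eqP; rewrite -subr_eq0; apply/eqP/l2norm_eq0.
  apply: (@geometric_le0 _ _ ((1 + 2 * K) * l2norm x)) => n.
  have e0 : 0 <= (2^-1 : R) ^+ n by rewrite exprn_ge0// invr_ge0.
  have eqn : Yn n.+1 + Yn n.+1 = T + (Yn n \o Yn n).
    apply: funext => z; rewrite -[LHS]/(Yn n.+1 z + Yn n.+1 z) /=.
    rewrite -[(_ *: _ : op) z]/((2^-1 : R)%:C *: (T z + Yn n (Yn n z))).
    rewrite -scalerDl -rmorphD /= (_ : 2^-1 + 2^-1 = 1 :> R) ?scale1r//; lra.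
  have -> : (Y + Y) x - (T + (Y \o Y)) x =
    (((Y - Yn n.+1) + (Y - Yn n.+1)) - ((Y \o Y) - (Yn n \o Yn n))) x.
    rewrite -[LHS]/(((Y + Y) - (T + (Y \o Y))) x); congr (_ x).
    rewrite addrACA -opprD eqn opprB -[RHS]addrA; congr (_ + _).
    by rewrite !opprD addrA subrK.
  have b1 := bounded_byD (hY n.+1) (hY n.+1).
  have b2 : bounded_by ((Y \o Y) - (Yn n \o Yn n)) (2 * K * 2^-1 ^+ n).
    apply: bounded_by_sqrB => //; first exact: bounded_by_le (sqrt_iter_bounded n).
    by have := hY n; rewrite mul1r.
  have [_ /(_ x) hx] := bounded_byB b1 b2. apply: (le_trans hx).
  rewrite [_ ^+ n.+1]exprS; have := l2norm_ge0 x; move: e0.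
  move: (2^-1 ^+ n) (l2norm x) => e a e0 a0.
  rewrite le_eqVlt; apply/orP; left; apply/eqP; by field.
apply: funext => x; rewrite -[LHS]/((x - Y x) - Y (x - Y x)) -[RHS]/(x - T x).
rewrite (linear_opB (cstar_linear MY)).
have := congr1 (fun A : op => A x) eq2.
rewrite -[LHS]/(Y x + Y x) -[RHS]/(T x + Y (Y x)) => e.
by rewrite opprB addrA addrAC -[x - Y x - Y x]addrA -opprD e opprD addrA subrK.
Qed.

End SquareRoot.
End CstarAlgebra.

(** * States are norm continuous *)

Section States.
Context (R : realType) (J : choiceType).
Local Notation H := (l2 R J).
Local Notation op := (H -> H).
Context (G : set op).
Context (G_adjointable :
  forall A, G A -> (exists K, bounded_by A K) /\ exists B, is_adjoint A B).
Local Notation M := (norm_closure (star_alg G)).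
Context (phi : op -> R[i]).
Context (phi_state : is_state M phi).
Implicit Types (x y : H) (A B T Y : op) (K L : R).

Lemma cstar_adjointP A B : M A -> is_adjoint A B -> M B.
Proof.
move=> MA AB; have [B' MB' AB'] := cstar_adjoint G_adjointable MA.
by rewrite (adjoint_unique AB AB').
Qed.

Lemma stateB A B : M A -> M B -> phi (A - B) = phi A - phi B.
Proof.
move=> hA hB; have := state_linear phi_state (-1) hB hA.
by rewrite scaleN1r mulN1r addrC [- _ + _]addrC.
Qed.

Lemma state0 : phi 0 = 0.
Proof.
have h := cstar_id G_adjointable.
by have := stateB h h; rewrite !subrr.
Qed.

Lemma stateZ c A : M A -> phi (c *: A) = c * phi A.
Proof.
move=> hA; have h0 : M 0 by rewrite -(subrr A); exact: cstarB.
by have := state_linear phi_state c hA h0; rewrite state0 !addr0.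
Qed.

(** Cauchy-Schwarz for the positive form (A, B) |-> phi (B^* A). *)
Lemma state_form_bound A A' B B' : M A -> M B -> is_adjoint A A' -> is_adjoint B B' ->
  phi (B' \o A) = (phi (A' \o B))^* /\
  normc (phi (A' \o B)) ^+ 2 <= complex.Re (phi (A' \o A)) * complex.Re (phi (B' \o B)).
Proof.
move=> MA MB hA hB.
have MA' := cstar_adjointP MA hA; have MB' := cstar_adjointP MB hB.
have lA' := cstar_linear G_adjointable MA'; have lB' := cstar_linear G_adjointable MB'.
have cc X Y : M X -> M Y -> M (X \o Y) by exact: cstar_comp.
apply: sesqui_form_bound;
  [exact: state_pos phi_state _ _ MA hA|exact: state_pos phi_state _ _ MB hB|].
move=> t.
have Mt : M (t *: B + A) := cstar_comb G_adjointable t MB MA.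
have := state_pos phi_state Mt (adjoint_comb t hB hA).
have -> : (t^* *: B' + A') \o (t *: B + A) =
    (t * t^*) *: (B' \o B) + (t^* *: (B' \o A) + (t *: (A' \o B) + (A' \o A))).
  apply: funext => x.
  rewrite -[LHS]/(t^* *: B' (t *: B x + A x) + A' (t *: B x + A x)).
  rewrite -[RHS]/((t * t^*) *: B' (B x) + (t^* *: B' (A x) + (t *: A' (B x) + A' (A x)))).
  by rewrite lA' lB' scalerDr scalerA [t * _]mulrC -addrA.
have M1 := cstar_comb G_adjointable t (cc _ _ MA' MB) (cc _ _ MA' MA).
have M2 := cstar_comb G_adjointable t^* (cc _ _ MB' MA) M1.
rewrite (state_linear phi_state _ (cc _ _ MB' MB) M2).
rewrite (state_linear phi_state _ (cc _ _ MB' MA) M1).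
rewrite (state_linear phi_state _ (cc _ _ MA' MB) (cc _ _ MA' MA)).
set a := phi (A' \o A); set b := phi (A' \o B).
set b' := phi (B' \o A); set c := phi (B' \o B) => h.
by rewrite (_ : _ + _ = t * t^* * c + (t^* * b' + (t * b + a)))//; ring.
Qed.

Lemma state_null_right A A' Y : M A -> is_adjoint A A' -> phi (A' \o A) = 0 -> M Y ->
  phi (Y \o A) = 0.
Proof.
move=> MA hA A0 MY; have [Y' MY' hY] := cstar_adjoint G_adjointable MY.
have [_] := state_form_bound MY' MA (adjoint_sym hY) hA.
rewrite A0 /= mulr0 => h; apply: eq0_normc; apply/eqP; rewrite -sqrf_eq0.
by rewrite eq_le h sqr_ge0.
Qed.

Lemma state_null_left A A' Y : M A -> is_adjoint A A' -> phi (A' \o A) = 0 -> M Y ->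
  phi (A' \o Y) = 0.
Proof.
move=> MA hA A0 MY; have [Y' MY' hY] := cstar_adjoint G_adjointable MY.
have [_] := state_form_bound MA MY hA hY.
rewrite A0 /= mul0r => h; apply: eq0_normc; apply/eqP; rewrite -sqrf_eq0.
by rewrite eq_le h sqr_ge0.
Qed.

(** 1 - T is the square of the self-adjoint operator 1 - Y, so phi is nonnegative on
    it. *)
Lemma state_contraction_sqr T : M T -> is_adjoint T T -> bounded_by T (2^-1 ^+ 2) ->
  complex.Re (phi T) <= 1.
Proof.
move=> MT sT bT.
have [Y [MY sY eY]] := sqrt_exists G_adjointable MT sT bT.
have Mid := cstar_id G_adjointable.
have := state_pos phi_state (cstarB G_adjointable Mid MY) (adjointB (@adjoint_id R J) sY).
rewrite eY stateB// (state_unit phi_state) lecE.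
by case: (phi T) => a b /= /andP[_]; rewrite subr_ge0.
Qed.

(** For |A| <= 1/2, |phi A|^2 <= phi (A^* A) <= 1; the general case follows by
    scaling. *)
Lemma state_bounded A K : M A -> 0 <= K -> bounded_by A K -> normc (phi A) <= 2 * K.
Proof.
move=> MA K0 bA.
(* The bound may be 0; any larger one will do for the scaling. *)
suff pos L : 0 < L -> bounded_by A L -> normc (phi A) <= 2 * L.
  rewrite leNgt; apply/negP => h.
  have Lp : 0 < (K + normc (phi A) / 2) / 2 by rewrite divr_gt0//; lra.
  have := pos _ Lp; rewrite leNgt => /(_ _)/negP; apply; last lra.
  by apply: bounded_by_le bA; lra.
move=> Lp bL; pose c := (2 * L)^-1.
have c0 : 0 < c by rewrite invr_gt0 mulr_gt0.
pose B := c%:C *: A.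
have MB : M B := cstarZ G_adjointable _ MA.
have bB : bounded_by B 2^-1.
  apply: bounded_by_le (bounded_byZ (ltW c0) bL).
  by rewrite /c invfM -mulrA mulVf ?mulr1// gt_eqF.
have [B' MB' hB] := cstar_adjoint G_adjointable MB.
have h2 : 0 <= (2^-1 : R) by rewrite invr_ge0.
have T1 : complex.Re (phi (B' \o B)) <= 1.
  apply: state_contraction_sqr; first exact: cstar_comp.
    exact: adjoint_comp (adjoint_sym hB) hB.
  by rewrite expr2; exact: bounded_by_comp h2 (adjoint_bounded bB hB) bB.
have Mid := cstar_id G_adjointable.
have [_] := state_form_bound Mid MB (@adjoint_id R J) hB.
rewrite -[id \o B]/B -[id \o id]/(id : op) (state_unit phi_state) [complex.Re 1]/= mul1r => h.
have n1 : normc (phi B) <= 1.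
  rewrite -ler_sqr ?nnegrE ?normc_ge0// expr1n; exact: le_trans h T1.
move: n1; rewrite stateZ// normcM normc_real gtr0_norm// /c ler_pdivrMl ?mulr_gt0//.
by rewrite mulr1.
Qed.

End States.

(** * Words of creators and annihilators in coordinates *)

Section Coordinates.
Context (R : realType).
Local Notation H := (l2 R incr_seq).
Local Notation op := (H -> H).
Implicit Types (x y : H) (A B : op) (s t p q r : seq int) (i j k : int).

(** Indexing by arbitrary sequences, with value 0 at the sequences that are not
    increasing, avoids carrying proofs of sortedness through words. *)
Definition fcoord x s : R[i] := oapp x 0 (insub s : option incr_seq).

Lemma fcoord_val x (u : incr_seq) : fcoord x (val u) = x u.
Proof. by rewrite /fcoord valK. Qed.

Lemma fcoord_unsorted x s : ~~ sorted <%R s -> fcoord x s = 0.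
Proof. by move=> ns; rewrite /fcoord insubN. Qed.

Lemma fcoord_inj x y : (forall s, sorted <%R s -> fcoord x s = fcoord y s) -> x = y.
Proof.
by move=> h; apply/val_inj/funext => u; have := h (val u) (valP u); rewrite !fcoord_val.
Qed.

Lemma op_eqP A B : (forall x s, sorted <%R s -> fcoord (A x) s = fcoord (B x) s) -> A = B.
Proof. by move=> h; apply: funext => x; apply: fcoord_inj; exact: h. Qed.

Lemma fcoord_comb c x y s : fcoord (c *: x + y) s = c * fcoord x s + fcoord y s.
Proof. by rewrite /fcoord; case: insubP => [u _ _|_] //=; rewrite mulr0 addr0. Qed.

Lemma fcoord0 s : fcoord 0 s = 0.
Proof. by rewrite /fcoord; case: insubP. Qed.

Lemma fcoordB x y s : fcoord (x - y) s = fcoord x s - fcoord y s.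
Proof. by rewrite addrC -scaleN1r fcoord_comb mulN1r addrC. Qed.

Lemma fcoord_creation i x t : fcoord (creation i x) t =
  if sorted <%R t then
    if t is j :: u then if j == i then fcoord x u else 0 else 0
  else 0.
Proof.
case: ifPn => [st|]; last exact: fcoord_unsorted.
rewrite {1}/fcoord insubT /= /tail_at /=.
by case: t st => [|j t] st //=; case: eqP.
Qed.

Lemma fcoord_annihilation i x t : fcoord (annihilation i x) t = fcoord x (i :: t).
Proof.
case: (boolP (sorted <%R t)) => [st|nst].
  by rewrite {1}/fcoord insubT.
rewrite !fcoord_unsorted//; apply: contra nst; exact: path_sorted.
Qed.

(** The projection a_k a_k^+ onto the sequences that start strictly after k. *)
Definition pos_proj k : op := annihilation k \o creation k.

Lemma fcoord_pos_proj k x t :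
  fcoord (pos_proj k x) t = if sorted <%R (k :: t) then fcoord x t else 0.
Proof. by rewrite fcoord_annihilation fcoord_creation eqxx. Qed.

Lemma fcoord_foldr_creation p B x t : sorted <%R t ->
  fcoord (foldr (fun i A => creation i \o A) B p x) t =
  if prefix p t then fcoord (B x) (drop (size p) t) else 0.
Proof.
elim: p t => [|i p IH] t st; first by rewrite prefix0s drop0.
rewrite -[foldr _ _ _ x]/(creation i (foldr (fun i A => creation i \o A) B p x)).
rewrite fcoord_creation st; case: t st => [|j t] //= st.
by rewrite eq_sym; case: eqP => //= _; apply: IH; exact: path_sorted st.
Qed.

Lemma fcoord_foldr_annihilation q x t :
  fcoord (foldr (fun j A => annihilation j \o A) id (rev q) x : H) t = fcoord x (q ++ t).
Proof.
elim/last_ind: q t => [|q j IH] t //.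
rewrite rev_rcons.
rewrite -[foldr _ _ _ x]/(annihilation j
  (foldr (fun i (A : op) => annihilation i \o A) id (rev q) x)).
by rewrite fcoord_annihilation IH cat_rcons.
Qed.

Lemma fcoord_word p q x t : sorted <%R t -> fcoord (word p (rev q) x) t =
  if prefix p t then fcoord x (q ++ drop (size p) t) else 0.
Proof.
by move=> st; rewrite fcoord_foldr_creation//; case: ifP => // _; rewrite fcoord_foldr_annihilation.
Qed.

(** The operator a_p^+ P_k a_q, which maps e_(q r) to e_(p r) for the sequences r that
    start strictly after k.  Left multiplication by a generator sends each of these
    operators to another one or to 0, which fails for the Hamel words. *)
Definition cut_word p k q : op :=
  foldr (fun i A => creation i \o A)
    (pos_proj k \o foldr (fun j A => annihilation j \o A) id (rev q)) p.

Lemma fcoord_cut_word p k q x t : sorted <%R t -> fcoord (cut_word p k q x) t =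
  if prefix p t && sorted <%R (k :: drop (size p) t)
  then fcoord x (q ++ drop (size p) t) else 0.
Proof.
move=> st; rewrite fcoord_foldr_creation//; case: ifP => //= _.
by rewrite fcoord_pos_proj /=; case: ifP => // _; rewrite fcoord_foldr_annihilation.
Qed.

Lemma cut_word_nil k : cut_word [::] k [::] = pos_proj k.
Proof. by []. Qed.

Lemma cut_word_sorted p k q : ~~ (sorted <%R p && sorted <%R q) -> cut_word p k q = 0.
Proof.
move=> npq; apply: op_eqP => x t st; rewrite fcoord_cut_word// fcoord0.
case: ifP => // /andP[/prefixP[r tE] _].
move: npq; rewrite negb_and => /orP[|] h.
  move: st; rewrite tE => st; move: h.
  by rewrite (subseq_sorted lt_trans (prefix_subseq p r) st).
rewrite fcoord_unsorted//; apply: contra h.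
exact: (subseq_sorted lt_trans (prefix_subseq _ _)).
Qed.

Definition bounded_by_last k p := if p is c :: p' then k <= last c p' else false.

(** A cut at k is automatic after a word whose last letter is at least k. *)
Lemma sorted_after_last k p r : bounded_by_last k p -> sorted <%R (p ++ r) ->
  sorted <%R (k :: r).
Proof.
case: p => // c p /= kl; rewrite cat_path => /andP[_].
by case: r => //= d r /andP[ld ->]; rewrite (le_lt_trans kl ld).
Qed.

Lemma cut_word_word p k q : bounded_by_last k p || bounded_by_last k q ->
  cut_word p k q = word p (rev q).
Proof.
move=> kpq; apply: op_eqP => x t st; rewrite fcoord_cut_word// fcoord_word//.
case: ifP => [/andP[-> //]|]; case: ifP => //= /prefixP[r tE] h.
rewrite tE drop_size_cat// in h *; rewrite fcoord_unsorted//; apply/negP => sqr.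
case/orP: kpq => hk; move/negP: h; apply.
  by apply: sorted_after_last hk _; rewrite -tE.
exact: sorted_after_last hk sqr.
Qed.

(** A sequence r starts after k - 1 when it starts after k or at k; in the second case
    the letter k moves into both words. *)
Lemma cut_word_step p k q :
  cut_word p k q = cut_word p (k - 1) q - cut_word (rcons p k) k (rcons q k).
Proof.
apply: op_eqP => x t st.
rewrite -[(_ - _ : op) x]/(cut_word p (k - 1) q x - cut_word (rcons p k) k (rcons q k) x).
rewrite fcoordB !fcoord_cut_word//.
case: (boolP (prefix p t)) => /= [/prefixP[r tE]|npt]; last first.
  case: ifP => [/andP[/prefixP[r tE] _]|_]; last by rewrite subr0.
  by rewrite tE -cats1 -catA prefix_prefix in npt.
rewrite tE -!cats1 size_cat /= addnC -drop_drop !drop_size_cat// prefix_catr// eqxx.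
have sr : sorted <%R r.
  by apply: (subseq_sorted lt_trans (suffix_subseq p r)); rewrite -tE.
case: r tE sr => [|c r] tE sr /=; first by rewrite subr0.
rewrite prefix0s andbT.
have [kc|ck|->] := ltgtP k c.
- rewrite /= in sr *; rewrite sr (_ : k - 1 < c) ?subr0//; lia.
- rewrite (_ : k - 1 < c = false) ?subr0//; lia.
- rewrite /= in sr *; rewrite drop0 sr (_ : c - 1 < c) -?catA ?subrr//; lia.
Qed.

(** If p starts with i the letter is removed, which leaves the condition that the rest
    start after i; if p is empty, i is removed from r, provided that k < i.  All
    other cases give zero. *)
Lemma annihilation_cut_word i p k q :
  annihilation i \o cut_word p k q = 0 \/
  exists p' k' q', annihilation i \o cut_word p k q = cut_word p' k' q'.
Proof.
have E x t : fcoord ((annihilation i \o cut_word p k q) x) t =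
    if [&& sorted <%R (i :: t), prefix p (i :: t) & sorted <%R (k :: drop (size p) (i :: t))]
    then fcoord x (q ++ drop (size p) (i :: t)) else 0.
  rewrite fcoord_annihilation; case: ifPn => [/and3P[st pt kt]|].
    by rewrite fcoord_cut_word// pt kt.
  case: (boolP (sorted <%R (i :: t))) => [st|nst _]; last by rewrite fcoord_unsorted.
  by rewrite fcoord_cut_word//= => /negbTE ->.
case: p E => [|c p] E.
  case: (ltP k i) => [ki|ik].
    right; exists [::], i, (rcons q i); apply: op_eqP => x t st.
    by rewrite E fcoord_cut_word//= ?drop0 ki prefix0s cat_rcons andbb.
  left; apply: op_eqP => x t st; rewrite E fcoord0 /= [k < i]ltNge ik /=.
  by rewrite andbF.
case: (eqVneq i c) => [ic|nic]; last first.
  left; apply: op_eqP => x t st.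
  by rewrite E fcoord0 /= [c == i]eq_sym (negbTE nic) andbF.
subst c; case: p E => [|c p] E.
  right; exists [::], (Num.max i k), q; apply: op_eqP => x t st.
  rewrite E fcoord_cut_word//= eqxx !prefix0s ?drop0 /=.
  case: t st => //= d t ->; rewrite !andbT gt_max.
  by case: ifP.
case: (ltP i c) => [ic|ci].
  right; exists (c :: p), k, q; apply: op_eqP => x t st.
  rewrite E fcoord_cut_word//= eqxx /=.
  case: t st => [|d t] //= ->; rewrite andbT.
  by case: (eqVneq c d) => [<-|]; rewrite ?ic ?andbF.
left; apply: op_eqP => x t st; rewrite E fcoord0 /= eqxx /=.
case: t st => [|d t] //= _.
by case: (eqVneq c d) => [<-|]; rewrite ?andbF// ltNge ci.
Qed.

End Coordinates.

(** * The algebra is spanned by the Hamel basis *)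

Section Span.
Context (R : realType).
Local Notation C := R[i].
Local Notation H := (l2 R incr_seq).
Local Notation op := (H -> H).
Local Notation index := ({fset int} * {fset int})%type.
Implicit Types (x y : H) (A B : op) (s t p q r : seq int) (i j k : int) (l : index).
Local Notation hamel := (@hamel R).
Local Notation cut_word := (@cut_word R).

Lemma fsum_scale (c : index -> C) (f : index -> op) (F : {fset index}) :
  (forall l, l \notin F -> c l = 0) ->
  \sum_(l \in [set: index]) c l *: f l = \sum_(l <- F) c l *: f l.
Proof.
move=> cF; rewrite (fsbigTE F) // => l /cF ->; exact: scale0r.
Qed.

Lemma fsupp_fset (c : index -> C) : finite_set (fsupp c) ->
  exists F : {fset index}, forall l, l \notin F -> c l = 0.
Proof.
move=> fc; exists (fset_set (fsupp c)) => l.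
by rewrite in_fset_set// notin_setE /fsupp /= => /negP; rewrite negbK => /eqP.
Qed.

Lemma fset_fsupp (c : index -> C) (F : {fset index}) :
  (forall l, l \notin F -> c l = 0) -> finite_set (fsupp c).
Proof.
move=> cF; apply: sub_finite_set (finite_fset F) => l; rewrite /fsupp /=.
by apply: contra_neqT => /cF.
Qed.

Definition in_span A := exists c : index -> C, finite_set (fsupp c) /\ A = lincomb c.

Lemma lincomb_fset (c : index -> C) (F : {fset index}) :
  (forall l, l \notin F -> c l = 0) -> lincomb c = \sum_(l <- F) c l *: hamel l.
Proof. exact: fsum_scale. Qed.

Lemma lincomb_comb (a : C) (c d : index -> C) : finite_set (fsupp c) -> finite_set (fsupp d) ->
  finite_set (fsupp (fun l => a * c l + d l)) /\
  lincomb (fun l => a * c l + d l) = a *: lincomb c + lincomb d :> op.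
Proof.
move=> /fsupp_fset[F hF] /fsupp_fset[E hE].
have hF' l : l \notin (F `|` E)%fset -> c l = 0.
  by rewrite inE negb_or => /andP[/hF].
have hE' l : l \notin (F `|` E)%fset -> d l = 0.
  by rewrite inE negb_or => /andP[_ /hE].
have h l : l \notin (F `|` E)%fset -> a * c l + d l = 0.
  by move=> lFE; rewrite hF'// hE'// mulr0 addr0.
split; first exact: fset_fsupp h.
rewrite (lincomb_fset h) (lincomb_fset hF') (lincomb_fset hE') scaler_sumr -big_split /=.
by apply: eq_bigr => l _; rewrite scalerA scalerDl.
Qed.

Definition delta l : index -> C := fun l' => (l' == l)%:R.

Lemma delta_out l l' : l' \notin [fset l]%fset -> delta l l' = 0.
Proof. by rewrite inE /delta => /negbTE ->. Qed.

Lemma delta_fsupp l : finite_set (fsupp (delta l)).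
Proof. exact: fset_fsupp (@delta_out l). Qed.

Lemma fsum_delta l (f : index -> op) : \sum_(l' \in [set: index]) delta l l' *: f l' = f l.
Proof.
by rewrite (fsum_scale _ (@delta_out l)) big_seq_fset1 /delta eqxx scale1r.
Qed.

Lemma lincomb_delta l : lincomb (delta l) = hamel l.
Proof. exact: fsum_delta. Qed.

Lemma hamel_in_span l : in_span (hamel l).
Proof. by exists (delta l); rewrite lincomb_delta; split=> //; exact: delta_fsupp. Qed.

Lemma in_span_comb (a : C) A B : in_span A -> in_span B -> in_span (a *: A + B).
Proof.
move=> [c [fc ->]] [d [fd ->]]; exists (fun l => a * c l + d l).
by have [f e] := lincomb_comb a fc fd.
Qed.

Lemma in_span0 : in_span 0.
Proof.
exists (fun=> 0); split; first by apply: (@fset_fsupp _ fset0).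
by rewrite (@lincomb_fset _ fset0)// big_seq_fset0.
Qed.

Lemma in_spanB A B : in_span A -> in_span B -> in_span (A - B).
Proof. by move=> hA hB; rewrite addrC -scaleN1r; exact: in_span_comb. Qed.

Lemma in_span_ind (P : op -> Prop) : P 0 ->
  (forall a l A, P A -> P (a *: hamel l + A)) -> forall A, in_span A -> P A.
Proof.
move=> P0 Pc A [c [/fsupp_fset[F hF] ->]]; rewrite (lincomb_fset hF).
elim: (enum_fset F) => [|l s IH]; first by rewrite big_nil.
by rewrite big_cons; exact: Pc.
Qed.

Lemma lincomb_functional (P : op -> Prop) (D : op -> C) (c : index -> C) (F : {fset index}) :
  P 0 -> (forall l, P (hamel l)) ->
  (forall a A B, P A -> P B -> P (a *: A + B) /\ D (a *: A + B) = a * D A + D B) ->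
  (forall l, l \notin F -> c l = 0) ->
  D (lincomb c) = \sum_(l <- F) c l * D (hamel l).
Proof.
move=> P0 Ph PD hF; rewrite (lincomb_fset hF).
have D0 : D 0 = 0.
  have [_] := PD (-1) 0 0 P0 P0; rewrite scaler0 addr0 mulN1r addNr.
  by [].
suff [] : P (\sum_(l <- F) c l *: hamel l) /\
  D (\sum_(l <- F) c l *: hamel l) = \sum_(l <- F) c l * D (hamel l) by [].
elim: (enum_fset F) => [|l s [IH1 IH2]]; first by rewrite !big_nil.
rewrite !big_cons; have [h1 h2] := PD (c l) _ _ (Ph l) IH1; split=> //.
by rewrite h2 IH2.
Qed.

Definition seq_index p q : index := ([fset i | i in p]%fset, [fset i | i in q]%fset).

Lemma incr_enum_sorted (I : {fset int}) : sorted <%R (incr_enum I).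
Proof.
by rewrite lt_sorted_uniq_le sort_uniq fset_uniq /=; apply: sort_sorted; exact: le_total.
Qed.

Lemma incr_enumK p : sorted <%R p -> incr_enum [fset i | i in p]%fset = p.
Proof.
move=> sp; apply: lt_sorted_eq => //; first exact: incr_enum_sorted.
by move=> i; rewrite mem_sort in_fset.
Qed.

Lemma incr_enum_inj : injective incr_enum.
Proof.
move=> I J e; apply/fsetP => i.
by rewrite -[i \in I](mem_sort <=%R) -[i \in J](mem_sort <=%R) -/(incr_enum _) e.
Qed.

(** The case analysis on sequences, as a test: the only exceptional index is a pair of
    equal singletons. *)
Lemma hamelE l : hamel l =
  if (size (incr_enum l.1) == 1)%N && (incr_enum l.1 == incr_enum l.2)
  then @pos_proj R (head 0 (incr_enum l.1))
  else word (incr_enum l.1) (rev (incr_enum l.2)).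
Proof.
rewrite /Defs.hamel; case: (incr_enum l.1) => [|i [|i' p]] //.
case: (incr_enum l.2) => [|j [|j' q]] //=.
by rewrite eqseq_cons andbT; case: eqVneq.
by rewrite eqseq_cons andbF.
Qed.

Lemma hamel_single i : hamel (seq_index [:: i] [:: i]) = @pos_proj R i.
Proof. by rewrite hamelE /= incr_enumK// eqxx. Qed.

Lemma hamel_word p q : sorted <%R p -> sorted <%R q -> (size p != 1)%N || (p != q) ->
  hamel (seq_index p q) = word p (rev q).
Proof. by move=> sp sq h; rewrite hamelE /= !incr_enumK// -[_ && _]negbK negb_and h. Qed.

Lemma hamel_id : hamel (fset0, fset0) = id.
Proof.
have e0 : [fset i | i in [::]]%fset = fset0 :> {fset int} by apply/fsetP => i; rewrite !inE.
by rewrite -e0 hamel_word.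
Qed.

Lemma pos_proj_in_span k : in_span (@pos_proj R k).
Proof. by rewrite -hamel_single; exact: hamel_in_span. Qed.

(** Both sides are the projection onto the sequences that start at i. *)
Lemma number_op i :
  creation i \o annihilation i = @pos_proj R (i - 1) - @pos_proj R i.
Proof.
have st : cut_word [::] i [::] = cut_word [::] (i - 1) [::] - cut_word [:: i] i [:: i].
  exact: (@cut_word_step R [::] i [::]).
have e : cut_word [:: i] i [:: i] = creation i \o annihilation i.
  by apply: (@cut_word_word R [:: i] i [:: i]); rewrite /= lexx.
by rewrite -(cut_word_nil R i) st -e subKr.
Qed.

Lemma word_in_span p q : sorted <%R p -> sorted <%R q -> in_span (word p (rev q)).
Proof.
move=> sp sq; case: (boolP ((size p != 1)%N || (p != q))) => [h|].
  by rewrite -hamel_word//; exact: hamel_in_span.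
rewrite negb_or !negbK => /andP[p1 /eqP <-]; case: p p1 {sp sq} => [|i [|]]// _.
rewrite [word _ _](number_op i); apply: in_spanB; exact: pos_proj_in_span.
Qed.

Lemma cut_word_bounded_in_span p k q : bounded_by_last k p || bounded_by_last k q ->
  in_span (cut_word p k q).
Proof.
case: (boolP (sorted <%R p && sorted <%R q)) => [/andP[sp sq] h|/cut_word_sorted -> _].
  by rewrite cut_word_word//; exact: word_in_span.
exact: in_span0.
Qed.

Lemma bounded_by_last_rcons k p : bounded_by_last k (rcons p k).
Proof. by case: p => [|c p] /=; rewrite ?last_rcons. Qed.

(** Lowering k one step at a time with cut_word_step produces Hamel words, until k
    reaches the last letter of p or q, where the cut becomes automatic. *)
Lemma cut_word_in_span p k q : in_span (cut_word p k q).
Proof.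
have far n k' : bounded_by_last (k' - n%:Z) p || bounded_by_last (k' - n%:Z) q ->
    in_span (cut_word p k' q).
  elim: n k' => [|n IH] k'.
    by rewrite subr0; exact: cut_word_bounded_in_span.
  rewrite (_ : k' - n.+1%:Z = k' - 1 - n%:Z); last by lia.
  move=> /IH h; rewrite cut_word_step; apply: in_spanB => //.
  by apply: cut_word_bounded_in_span; rewrite bounded_by_last_rcons.
case: p far => [|c p] far.
  case: q far => [|d q] far; first by rewrite cut_word_nil; exact: pos_proj_in_span.
  by apply: (far `|k - last d q|%N); apply/orP; right; rewrite /=; lia.
by apply: (far `|k - last c p|%N); apply/orP; left; rewrite /=; lia.
Qed.

Lemma hamel_cut_word l : hamel l = id \/ exists p k q, hamel l = cut_word p k q.
Proof.
have sp := incr_enum_sorted l.1; have sq := incr_enum_sorted l.2.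
rewrite hamelE; move: (incr_enum l.1) (incr_enum l.2) sp sq => p q sp sq.
case: ifP => _; first by right; exists [::], (head 0 p), [::]; rewrite cut_word_nil.
case: p sp => [|c p] sp.
  case: q sq => [|d q] sq; first by left.
  by right; exists [::], (last d q), (d :: q); rewrite cut_word_word//= lexx.
by right; exists (c :: p), (last c p), q; rewrite cut_word_word//= lexx.
Qed.

Lemma creation_in_span i : in_span (creation i).
Proof. exact: (@word_in_span [:: i] [::]). Qed.

Lemma annihilation_in_span i : in_span (annihilation i).
Proof. exact: (@word_in_span [::] [:: i]). Qed.

Lemma creation_linear i : linear (@creation R i).
Proof.
move=> a x y; apply: fcoord_inj => s ss; rewrite fcoord_comb !fcoord_creation ss.
case: s {ss} => [|j s]; first by rewrite mulr0 addr0.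
by case: eqP => _; [exact: fcoord_comb|rewrite mulr0 addr0].
Qed.

Lemma annihilation_linear i : linear (@annihilation R i).
Proof.
by move=> a x y; apply: fcoord_inj => s ss; rewrite fcoord_comb !fcoord_annihilation fcoord_comb.
Qed.

Lemma mul_in_span (X : op) : linear X -> in_span X ->
  (forall p k q, X \o cut_word p k q = 0 \/
     exists p' k' q', X \o cut_word p k q = cut_word p' k' q') ->
  forall B, in_span B -> in_span (X \o B).
Proof.
move=> lX sX XV; apply: in_span_ind => [|a l A IH].
  rewrite (_ : X \o 0 = 0); first exact: in_span0.
  by apply: funext => x; exact: linear_op0.
rewrite (_ : X \o _ = a *: (X \o hamel l) + (X \o A)); last first.
  by apply: funext => x; exact: lX.
apply: in_span_comb => //.
have [->//|[p [k [q ->]]]] := hamel_cut_word l.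
have [->|[p' [k' [q' ->]]]] := XV p k q; first exact: in_span0.
exact: cut_word_in_span.
Qed.

(** The induction carries the stability of the span under left multiplication by an
    adjoint as well, because star_alg is closed under adjunction. *)
Lemma star_alg_in_span A : mono_star_alg A -> in_span A.
Proof.
move=> SA; suff [_ [_ h _]] : exists A', [/\ is_adjoint A A',
    (forall B, in_span B -> in_span (A \o B)) & forall B, in_span B -> in_span (A' \o B)].
  by apply: (h id); rewrite -hamel_id; exact: hamel_in_span.
elim: SA => {A} [_ [i _ <-]||c A B _ [A' [hA a1 a2]] _ [B' [hB b1 b2]]|
    A B _ [A' [hA a1 a2]] _ [B' [hB b1 b2]]|A B _ [A' [hA a1 a2]] AB].
- exists (creation i); split; first exact: annihilation_adjoint.
    apply: mul_in_span; [exact: annihilation_linear|exact: annihilation_in_span|].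
    exact: annihilation_cut_word.
  apply: mul_in_span; [exact: creation_linear|exact: creation_in_span|].
  by move=> p k q; right; exists (i :: p), k, q.
- by exists id; split=> //; exact: adjoint_id.
- exists (c^* *: A' + B'); split; first exact: adjoint_comb.
    by move=> X sX; apply: (in_span_comb c (a1 _ sX) (b1 _ sX)).
  by move=> X sX; apply: (in_span_comb c^* (a2 _ sX) (b2 _ sX)).
- exists (B' \o A'); split; first exact: adjoint_comp.
    by move=> X sX; exact: a1 (b1 _ sX).
  by move=> X sX; exact: b2 (a2 _ sX).
- exists A; split; first exact: adjoint_sym.
    by rewrite -(adjoint_unique hA AB).
  exact: a1.
Qed.

Lemma annihilation_star_alg i : mono_star_alg (@annihilation R i).
Proof. by apply: star_alg_gen; exists i. Qed.

Lemma creation_star_alg i : mono_star_alg (@creation R i).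
Proof. exact: star_alg_adj (annihilation_star_alg i) (annihilation_adjoint i). Qed.

Lemma word_star_alg p q : mono_star_alg (@word R p q).
Proof.
rewrite /word; elim: p => [|i p IH] /=; last exact: star_alg_comp (creation_star_alg i) IH.
elim: q => [|i q IH] /=; last exact: star_alg_comp (annihilation_star_alg i) IH.
exact: star_alg_id.
Qed.

Lemma pos_proj_star_alg k : mono_star_alg (@pos_proj R k).
Proof. exact: star_alg_comp (annihilation_star_alg k) (creation_star_alg k). Qed.

Lemma hamel_star_alg l : mono_star_alg (hamel l).
Proof. by rewrite hamelE; case: ifP => _; [exact: pos_proj_star_alg|exact: word_star_alg]. Qed.

Lemma star_alg0 : mono_star_alg (0 : op).
Proof.
have := star_alg_lin (-1) (@star_alg_id _ _ (range (@annihilation R))) (@star_alg_id _ _ _).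
by rewrite scaleN1r addNr.
Qed.

Lemma in_span_star_alg A : in_span A -> mono_star_alg A.
Proof.
apply: (@in_span_ind (fun A => mono_star_alg A)) => [|a l B]; first exact: star_alg0.
exact/star_alg_lin/hamel_star_alg.
Qed.

End Span.

(** * The Hamel basis is free *)

Section Freeness.
Context (R : realType).
Local Notation C := R[i].
Local Notation H := (l2 R incr_seq).
Local Notation op := (H -> H).
Local Notation index := ({fset int} * {fset int})%type.
Implicit Types (x y : H) (A B : op) (s t p q r : seq int) (i j k : int) (l : index).
Local Notation hamel := (@hamel R).

Definition ebasis s : H := oapp (@basis_vec R) 0 (insub s).

Lemma fcoord_ebasis s t : sorted <%R s -> fcoord (ebasis s) t = (t == s)%:R.
Proof.
move=> ss; rewrite /ebasis insubT /fcoord; case: insubP => [u _ <-|nst] //=.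
by case: eqP => // ts; rewrite ts ss in nst.
Qed.

(** The matrix entry <A e_s, e_t>. *)
Definition entry A s t : C := fcoord (A (ebasis s)) t.

Lemma entry_comb a A B s t : entry (a *: A + B) s t = a * entry A s t + entry B s t.
Proof. exact: fcoord_comb. Qed.

Definition is_single p q := (size p == 1)%N && (p == q).

(** When the matrix entry at (s, t) of the Hamel element of (p, q) is 1 instead
    of 0. *)
Definition hamel_support p q s t :=
  if is_single p q then sorted <%R (head 0 p :: t) && (t == s)
  else prefix p t && (q ++ drop (size p) t == s).

Lemma entry_hamel l s t : sorted <%R s -> sorted <%R t ->
  entry (hamel l) s t = (hamel_support (incr_enum l.1) (incr_enum l.2) s t)%:R.
Proof.
move=> ss st; rewrite /entry hamelE /hamel_support -/(is_single _ _); case: ifP => _.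
  by rewrite fcoord_pos_proj; case: ifP => // _; rewrite fcoord_ebasis.
by rewrite fcoord_word//; case: ifP => // _; rewrite fcoord_ebasis.
Qed.

Lemma single_or p q : is_single p q -> exists j, p = [:: j] /\ q = [:: j].
Proof. by case: p => [|j [|]]//= /andP[_ /eqP <-]; exists j. Qed.

(** A word maps e_s to e_t exactly when s and t are q and p followed by the same
    sequence. *)
Lemma suffix_splitP p q s t :
  reflect (exists r, t = p ++ r /\ s = q ++ r) (prefix p t && (q ++ drop (size p) t == s)).
Proof.
apply: (iffP andP) => [[/prefixP[r tE] /eqP sE]|[r [-> ->]]].
  by exists r; split=> //; rewrite -sE tE drop_size_cat.
by rewrite prefix_prefix drop_size_cat// eqxx.
Qed.

Lemma hamel_support_no_common_last p q s t :
  (forall p1 q1 c, ~ (t = rcons p1 c /\ s = rcons q1 c)) -> (t != [::]) || (s != [::]) ->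
  hamel_support p q s t = (p == t) && (q == s).
Proof.
move=> nc ne; rewrite /hamel_support; case: ifP => [/single_or[j [-> ->]]|_].
  have ts : t != s.
    apply/eqP => ts; subst s; rewrite orbb in ne.
    by case/lastP: t nc ne => // t c /(_ t t c) [].
  rewrite (negbTE ts) andbF; apply/esym/negbTE; apply: contra ts.
  by move=> /andP[/eqP <- /eqP <-].
apply/suffix_splitP/andP => [[r [tE sE]]|[/eqP -> /eqP ->]]; last first.
  by exists [::]; rewrite !cats0.
case/lastP: r tE sE => [|r c]; first by rewrite !cats0 => -> ->.
by rewrite -!rcons_cat => tE sE; case: (nc _ _ _ (conj tE sE)).
Qed.

(** Decompositions of (t c, s c) with a nonempty common tail correspond to the
    decompositions of (t, s), so the difference leaves the one with empty tail.  The
    projections P_j have equal entries at both places, unless s and t are both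
    empty. *)
Lemma hamel_support_common_last p q s t c : sorted <%R (rcons t c) ->
  (t != [::]) || (s != [::]) ->
  (hamel_support p q (rcons s c) (rcons t c))%:R - (hamel_support p q s t)%:R =
  ((p == rcons t c) && (q == rcons s c))%:R :> C.
Proof.
move=> st ne; rewrite /hamel_support; case: ifP => [/single_or[j [-> ->]]|_].
  rewrite [RHS](_ : _ = 0); last first.
    case: eqP => //= et; case: eqP => // es.
    by case: t s ne et es {st} => [|? [|? ?]] [|? [|? ?]].
  rewrite eqseq_rcons eqxx andbT; case: (eqVneq t s) => ts; last by rewrite !andbF subrr.
  subst s; rewrite orbb in ne; case: t st ne => //= d t st _.
  have -> : path <%R d t.
    by apply: (subseq_sorted lt_trans (prefix_subseq (d :: t) [:: c])); rewrite cats1.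
  by rewrite st subrr.
have -> : prefix p (rcons t c) && (q ++ drop (size p) (rcons t c) == rcons s c) =
  (prefix p t && (q ++ drop (size p) t == s)) || (p == rcons t c) && (q == rcons s c).
  apply/suffix_splitP/orP => [[r []]|[/suffix_splitP[r [-> ->]]|/andP[/eqP -> /eqP ->]]].
  - case/lastP: r => [|r d]; first by rewrite !cats0 => -> ->; right; rewrite !eqxx.
    rewrite -!rcons_cat => /rcons_inj[-> _] /rcons_inj[-> _].
    by left; apply/suffix_splitP; exists r.
  - by exists (rcons r c); rewrite !rcons_cat.
  - by exists [::]; rewrite !cats0.
case: suffix_splitP => [[r [tE sE]]|_] /=; last by rewrite subr0.
case: eqP => [pE|_] /=; last by rewrite subrr.
have : (size p <= size t)%N by rewrite tE size_cat leq_addr.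
by rewrite pE size_rcons ltnn.
Qed.

Lemma hamel_support_letter p q c : ~~ is_single p q ->
  hamel_support p q [:: c] [:: c] = (p == [::]) && (q == [::]).
Proof.
move=> ns; rewrite /hamel_support (negbTE ns).
case: p ns => [|e [|e' p]] ns /=; last by rewrite andbF.
  by case: q {ns} => [|? [|? ?]] /=; rewrite ?eqxx ?eqseq_cons ?andbF.
apply/negbTE/negP => /andP[/andP[/eqP ec _]]; rewrite cats0 => /eqP qE.
by move: ns; rewrite qE ec /is_single /= eqxx.
Qed.

(** The words that contribute to a diagonal entry at a one-letter sequence are the
    identity and the P_j, and only P_c changes between c and c + 1. *)
Lemma hamel_support_diagonal p q c :
  (hamel_support p q [:: c + 1] [:: c + 1])%:R - (hamel_support p q [:: c] [:: c])%:R =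
  ((p == [:: c]) && (q == [:: c]))%:R :> C.
Proof.
have [/single_or[j [-> ->]]|ns] := boolP (is_single p q).
  rewrite /hamel_support /is_single /= !eqxx !andbT !eqseq_cons !andbT andbb.
  rewrite (_ : (j < c + 1) = (j < c) || (j == c)); last by lia.
  by case: ltgtP => //=; rewrite ?subrr ?subr0.
rewrite !hamel_support_letter// subrr; case: eqP => //= pE; case: eqP => //= qE.
by move: ns; rewrite pE qE /is_single /= eqxx.
Qed.

Lemma incr_enum0 : incr_enum fset0 = [::].
Proof. by apply/nilP; rewrite /nilp /incr_enum size_sort cardfs0. Qed.

(** No dual functional is a finite combination of matrix entries for the identity,
    whose coefficient is visible only far to the left; the other ones are. *)
Lemma hamel_dual l : l <> (fset0, fset0) -> exists D : op -> C,
  (forall a A B, D (a *: A + B) = a * D A + D B) /\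
  forall l', D (hamel l') = (l' == l)%:R.
Proof.
move=> l0.
have eqE l' : (l' == l) = (incr_enum l'.1 == incr_enum l.1) && (incr_enum l'.2 == incr_enum l.2).
  by case: l l' {l0} => [I J] [I' J'] /=; rewrite !(inj_eq incr_enum_inj).
have : (incr_enum l.1 != [::]) || (incr_enum l.2 != [::]).
  rewrite -incr_enum0 !(inj_eq incr_enum_inj) -negb_and.
  by apply/negP => /andP[/eqP l1 /eqP l2]; apply: l0; case: l l1 l2 {eqE} => I J /= -> ->.
have := incr_enum_sorted l.1; have := incr_enum_sorted l.2.
set p := incr_enum l.1 in eqE *; set q := incr_enum l.2 in eqE * => sq sp.
have difference s t s' t' : sorted <%R s -> sorted <%R t -> sorted <%R s' -> sorted <%R t' ->
  (forall p' q', (hamel_support p' q' s t)%:R - (hamel_support p' q' s' t')%:R =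
     ((p' == p) && (q' == q))%:R :> C) ->
  exists D : op -> C, (forall a A B, D (a *: A + B) = a * D A + D B) /\
    forall l', D (hamel l') = (l' == l)%:R.
  move=> ss st ss' st' h; exists (fun A => entry A s t - entry A s' t'); split.
    by move=> a A B; rewrite !entry_comb; ring.
  by move=> l'; rewrite !entry_hamel// h eqE.
have [common|nocommon] := pselect (exists p1 q1 c, p = rcons p1 c /\ q = rcons q1 c); last first.
  move=> ne; exists (fun A => entry A q p); split; first by move=> *; exact: entry_comb.
  move=> l'; rewrite entry_hamel// eqE hamel_support_no_common_last//.
  by move=> p1 q1 c pq; apply: nocommon; exists p1, q1, c.
move=> _; case: common => p1 [q1 [c [pE qE]]].
have sub (u : seq int) : sorted <%R (rcons u c) -> sorted <%R u.
  by rewrite -cats1; exact: (subseq_sorted lt_trans (prefix_subseq _ _)).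
have [ne|] := boolP ((p1 != [::]) || (q1 != [::])).
  apply: (difference q p q1 p1) => //; try by apply: sub; rewrite -?pE -?qE.
  by move=> p' q'; rewrite pE qE hamel_support_common_last// -pE.
rewrite negb_or !negbK => /andP[/eqP p10 /eqP q10].
apply: (difference [:: c + 1] [:: c + 1] [:: c] [:: c]) => // p' q'.
by rewrite hamel_support_diagonal pE qE p10 q10.
Qed.

Lemma entry_nil_hamel l : entry (hamel l) [::] [::] =
  ((l == (fset0, fset0)) || is_single (incr_enum l.1) (incr_enum l.2))%:R.
Proof.
rewrite entry_hamel// /hamel_support; case: ifP => [_|_]; first by rewrite orbT.
rewrite orbF prefixs0 /= cats0 -incr_enum0 !(inj_eq incr_enum_inj).
by case: l => I J; rewrite xpair_eqE.
Qed.

Lemma big_fset_delta (c : index -> C) (F : {fset index}) : (forall l, l \notin F -> c l = 0) ->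
  forall l, \sum_(l' <- F) c l' * (l' == l)%:R = c l.
Proof.
move=> hF l; case: (boolP (l \in F)) => [lF|lF].
  rewrite (big_fsetD1 l)//= eqxx mulr1 big1_fset ?addr0// => l'.
  by rewrite !inE => /andP[/negbTE -> _]; rewrite mulr0.
rewrite (hF _ lF) big1_fset// => l' l'F _; case: eqP => [ll|_]; last by rewrite mulr0.
by move: lF; rewrite -ll l'F.
Qed.

(** The dual functionals show that a relation involves the identity alone; then its
    coefficient is zero by the vacuum entry. *)
Lemma lincomb_inj (c d : index -> C) : finite_set (fsupp c) -> finite_set (fsupp d) ->
  lincomb c = lincomb d :> op -> c = d.
Proof.
move=> fc fd cd; have [] := lincomb_comb (-1) fc fd.
set e := (fun l => _) => fe eE.
have eP l : e l = -1 * c l + d l by [].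
clearbody e.
have {eE} e0 : lincomb e = 0 :> op by rewrite eE cd scaleN1r addNr.
have [F hF] := fsupp_fset fe.
have eval (D : op -> C) : (forall a A B, D (a *: A + B) = a * D A + D B) ->
    0 = \sum_(l <- F) e l * D (hamel l).
  move=> lD; rewrite -(@lincomb_functional R (fun=> True) D _ F)//.
  by rewrite e0; have := lD (-1) 0 0; rewrite scaler0 addr0 mulN1r addNr.
have pick := big_fset_delta hF.
have el l : l <> (fset0, fset0) -> e l = 0.
  move=> /hamel_dual[D [lD hD]].
  by rewrite [RHS](eval D lD) -pick; apply: eq_bigr => l' _; rewrite hD.
have ez l : e l = 0.
  have [->|/eqP] := eqVneq l (fset0, fset0); last exact: el.
  rewrite -pick [RHS](eval (fun A => entry A [::] [::]) (fun _ _ _ => entry_comb _ _ _ _ _)).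
  apply: eq_bigr => l' _; have [->|/eqP /el ->] := eqVneq l' (fset0, fset0); last by rewrite !mul0r.
  by rewrite entry_nil_hamel eqxx.
apply: funext => l; have := ez l; rewrite eP mulN1r => /eqP.
by rewrite addrC subr_eq0 => /eqP.
Qed.

Lemma hamel_coord_hamel l : hamel_coord (hamel l) = delta R l.
Proof.
rewrite /hamel_coord; set S := (X in xget 0 X).
have [f e] : S (xget 0 S).
  by apply: (xgetPex 0); exists (delta R l); split; [exact: delta_fsupp|rewrite lincomb_delta].
by apply: lincomb_inj => //; [exact: delta_fsupp|rewrite -e lincomb_delta].
Qed.

Lemma T_perm_hamel sigma l : T_perm sigma (hamel l) = @hamel_perm R sigma l.
Proof. by rewrite /T_perm hamel_coord_hamel; exact: fsum_delta. Qed.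

End Freeness.

(** * The monotone algebra, its closure and its state at infinity *)

Section FockSpace.
Context (R : realType).
Local Notation C := R[i].
Local Notation H := (l2 R incr_seq).
Local Notation op := (H -> H).
Local Notation index := ({fset int} * {fset int})%type.
Implicit Types (x y : H) (A B : op) (s t p q r : seq int) (i j k : int) (l : index).
Local Notation hamel := (@hamel R).
Local Notation M := (@mono_Cstar_alg R).
Local Notation vacuum_index := (fset0 : {fset int}, fset0 : {fset int}).

Lemma inner_basis x (u : incr_seq) : inner x (basis_vec R u) = x u.
Proof.
rewrite /inner (csum_single (s := u)) => [|v vu] /=.
  by rewrite eqxx rmorph1 mulr1.
by rewrite (negbTE vu) rmorph0 mulr0.
Qed.

Lemma l2norm_basis (u : incr_seq) : l2norm (basis_vec R u) = 1.
Proof.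
have := inner_self (basis_vec R u); rewrite inner_basis /= eqxx => /(congr1 (@complex.Re R)) /=.
by move=> /esym/eqP; rewrite sqrp_eq1 ?l2norm_ge0// => /eqP.
Qed.

Lemma fcoord_le_l2norm x s : normc (fcoord x s) <= l2norm x.
Proof.
rewrite /fcoord; case: insubP => [u _ _|_] /=; first exact: coord_le_l2norm.
by rewrite expr0n addr0 sqrtr0 l2norm_ge0.
Qed.

Lemma entry_bound A K s t : bounded_by A K -> sorted <%R s -> normc (entry A s t) <= K.
Proof.
move=> [_ bA] ss; apply: le_trans (fcoord_le_l2norm _ _) _.
by apply: le_trans (bA _) _; rewrite /ebasis insubT /= l2norm_basis mulr1.
Qed.

Lemma vacuum_stateE A : vacuum_state A = entry A [::] [::].
Proof.
rewrite /vacuum_state inner_basis /entry -(fcoord_val _ nil_seq); congr (fcoord (A _) _).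
by rewrite /ebasis insubT /vacuum_vec /=; congr basis_vec; exact: val_inj.
Qed.

(** B A is a self-adjoint idempotent, and |A x| = |B A x|. *)
Lemma partial_isometry_bounded (J : choiceType) (A B : l2 R J -> l2 R J) :
  linear A -> is_adjoint A B -> A \o B \o A = A -> bounded_by A 1.
Proof.
move=> lA AB ABA; split=> // x; rewrite mul1r.
have eA z : A (B (A z)) = A z by exact: (congr1 (fun T => T z) ABA).
pose w := B (A x).
have nA : l2norm (A x) = l2norm w.
  apply/eqP; rewrite -(@eqrXn2 _ 2) ?l2norm_ge0//; apply/eqP.
  have : (l2norm (A x) ^+ 2)%:C = (l2norm w ^+ 2)%:C by rewrite -!inner_self -{1}eA AB.
  by move=> [].
have [w0|w0] := leP (l2norm w) 0; first by rewrite nA (le_trans w0)// l2norm_ge0.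
have : l2norm w ^+ 2 <= l2norm w * l2norm x.
  rewrite -[l2norm w ^+ 2]ger0_norm ?sqr_ge0// -normc_real -inner_self.
  rewrite {2}/w -AB eA AB -/w mulrC; exact: cauchy_schwarz.
by rewrite nA expr2 ler_pM2l.
Qed.

Lemma annihilation_bounded i : bounded_by (@annihilation R i) 1.
Proof.
apply: partial_isometry_bounded; [exact: annihilation_linear|exact: annihilation_adjoint|].
apply: op_eqP => x t st; rewrite -[LHS]/(fcoord (@pos_proj R i (annihilation i x)) t).
rewrite fcoord_pos_proj !fcoord_annihilation; case: ifPn => // nst.
by rewrite fcoord_unsorted.
Qed.

Lemma annihilation_adjointable A : range (@annihilation R) A ->
  (exists K, bounded_by A K) /\ exists B, is_adjoint A B.
Proof.
move=> [i _ <-]; split; first by exists 1; exact: annihilation_bounded.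
by exists (creation i); exact: annihilation_adjoint.
Qed.
Local Notation adj := annihilation_adjointable.

Lemma mono_cstarP A : M A <-> (exists K, bounded_by A K) /\
  forall e : R, 0 < e -> exists2 c : index -> C,
    finite_set (fsupp c) & bounded_by (A - lincomb c) e.
Proof.
split=> [/(cstarP adj)[bA h]|[bA h]].
  by split=> // e /h[B /star_alg_in_span[c [fc ->]] hB]; exists c.
apply/(cstarP adj); split=> // e /h[c fc hc]; exists (lincomb c) => //.
by apply: in_span_star_alg; exists c.
Qed.

Lemma lincomb_cstar (c : index -> C) : finite_set (fsupp c) -> M (lincomb c).
Proof. by move=> fc; apply: (star_alg_cstar adj); apply: in_span_star_alg; exists c. Qed.

Lemma frakAP A : @frakA R A <-> (exists K, bounded_by A K) /\
  forall e : R, 0 < e -> exists c : index -> C,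
    [/\ finite_set (fsupp c), c vacuum_index = 0 & bounded_by (A - lincomb c) e].
Proof.
rewrite /frakA norm_closureP => [|B [c [fc _ ->]]]; last first.
  exact: (cstar_linear adj (lincomb_cstar fc)).
split=> -[bA h]; split=> // e /h.
  by move=> [B [c [fc c0 ->]] hB]; exists c.
by move=> [c [fc c0 hc]]; exists (lincomb c) => //; exists c.
Qed.

Lemma int_lower_bound (s : seq int) : exists k, forall i, i \in s -> k <= i.
Proof.
elim: s => [|i s [k hk]]; first by exists 0.
exists (Num.min i k) => j; rewrite inE => /orP[/eqP ->|/hk kj].
  by rewrite ge_min lexx.
by rewrite ge_min kj orbT.
Qed.

Lemma lincomb_entry (c : index -> C) (F : {fset index}) s t :
  (forall l, l \notin F -> c l = 0) ->
  entry (lincomb c) s t = \sum_(l <- F) c l * entry (hamel l) s t.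
Proof.
move=> hF; rewrite (@lincomb_functional R (fun=> True) (fun A => entry A s t) _ F)//.
by move=> a A B _ _; split=> //; exact: entry_comb.
Qed.

(** The words other than the identity and the P_j vanish on the diagonal at one-letter
    sequences, and P_j vanishes at (k) for k <= j. *)
Lemma entry_far_left (c : index -> C) : finite_set (fsupp c) -> c vacuum_index = 0 ->
  exists k0, forall k, k <= k0 -> entry (lincomb c) [:: k] [:: k] = 0.
Proof.
move=> /fsupp_fset[F hF] c0.
have [k0 hk0] := int_lower_bound [seq head 0 (incr_enum l.1) | l <- enum_fset F].
exists k0 => k kk0; rewrite (lincomb_entry _ _ hF) big_seq big1// => l lF.
have [->|l0] := eqVneq l vacuum_index; first by rewrite c0 mul0r.
rewrite entry_hamel//; case: (boolP (is_single (incr_enum l.1) (incr_enum l.2))) => [s|ns].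
  rewrite /hamel_support s /= ltNge (le_trans kk0) ?mulr0//.
  by apply: hk0; apply/mapP; exists l.
rewrite hamel_support_letter// -incr_enum0 !(inj_eq incr_enum_inj).
by move: l0; case: l {lF ns} => I J; rewrite xpair_eqE => /negbTE ->; rewrite mulr0.
Qed.

Lemma entryB A B s t : entry (A - B) s t = entry A s t - entry B s t.
Proof. exact: fcoordB. Qed.

Lemma frakA_far_left A (e : R) : frakA A -> 0 < e ->
  exists2 B, bounded_by (A - B) e & exists k0, forall k, k <= k0 -> entry B [:: k] [:: k] = 0.
Proof.
move=> /frakAP[_ hA] /hA[c [fc c0 hc]]; exists (lincomb c) => //.
exact: entry_far_left.
Qed.

Lemma frakA_unique A (c d : C) : frakA (A - c *: id) -> frakA (A - d *: id) -> c = d.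
Proof.
move=> hc hd; apply/eqP; rewrite -subr_eq0; apply/eqP/eq0_normc.
apply: (@geometric_eq0 _ _ 2) => [|n]; first exact: normc_ge0.
have e0 : 0 < (2^-1 : R) ^+ n by rewrite exprn_gt0// invr_gt0.
have [B hb [k1 h1]] := frakA_far_left hc e0.
have [B' hb' [k2 h2]] := frakA_far_left hd e0.
pose k := Num.min k1 k2.
have := @entry_bound _ _ [:: k] [:: k] (bounded_byB hb' hb) isT.
have kk1 : k <= k1 by rewrite /k ge_min lexx.
have kk2 : k <= k2 by rewrite /k ge_min lexx orbT.
rewrite (entryB _ (A - c *: id - B)) (entryB (A - c *: id)).
rewrite (entryB (A - d *: id)) (entryB A (c *: id)) (entryB A (d *: id)).
rewrite (h1 _ kk1) (h2 _ kk2).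
have eid a : entry (a *: id : op) [:: k] [:: k] = a.
  rewrite -[(a *: id : op)]addr0 entry_comb /entry fcoord0 addr0.
  by rewrite fcoord_ebasis// eqxx mulr1.
rewrite (eid d) (eid c); move: (entry A _ _) => u.
rewrite (_ : u - d - 0 - (u - c - 0) = c - d); last by ring.
by move/le_trans; apply; lra.
Qed.

Lemma state_at_infinityE A c : frakA (A - c *: id) -> state_at_infinity A = c.
Proof.
move=> h; rewrite /state_at_infinity; set S := (X in xget 0 X).
have hS : S (xget 0 S) by apply: (xgetPex 0); exists c.
exact: frakA_unique hS h.
Qed.

Definition swap i j : int -> int := fun z => if z == i then j else if z == j then i else z.

Lemma swap_finite_perm i j : finite_perm (swap i j).
Proof.
split.
  apply: inv_bij => z; rewrite /swap; case: (eqVneq z i) => [->|zi].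
    by rewrite eqxx; case: (eqVneq j i).
  case: (eqVneq z j) => [->|zj]; first by rewrite eqxx.
  by rewrite (negbTE zi) (negbTE zj).
apply: (@sub_finite_set _ _ [set` [fset i; j]%fset]); last exact: finite_fset.
move=> z /=; rewrite !inE /swap; case: (eqVneq z i) => //= zi.
by case: (eqVneq z j) => //= zj; rewrite eqxx.
Qed.

Lemma hamel_perm_swap i j : hamel_perm (swap i j) (seq_index [:: i] [:: i]) = @pos_proj R j.
Proof.
have e : [fset swap i j z | z in [fset z | z in [:: i]]]%fset = [fset z | z in [:: j]]%fset.
  apply/fsetP => z; apply/imfsetP/idP => /= [[y]|].
    by rewrite !in_fset !inE => /eqP -> ->; rewrite /swap eqxx.
  by rewrite in_fset inE => /eqP ->; exists i; rewrite ?in_fset ?inE// /swap eqxx.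
by rewrite /hamel_perm /OP /= incr_enumK//= e -hamel_single.
Qed.

End FockSpace.

(** * Invariant states *)

Section SymmetricStates.
Context (R : realType).
Local Notation C := R[i].
Local Notation H := (l2 R incr_seq).
Local Notation op := (H -> H).
Local Notation index := ({fset int} * {fset int})%type.
Implicit Types (x y : H) (A B : op) (s t p q r : seq int) (i j k : int) (l : index).
Local Notation hamel := (@hamel R).
Local Notation M := (@mono_Cstar_alg R).
Local Notation adj := (@annihilation_adjointable R).
Local Notation vacuum_index := (fset0 : {fset int}, fset0 : {fset int}).
Context (phi : op -> C).
Context (phi_state : is_state M phi)
  (phi_inv : forall sigma : int -> int, finite_perm sigma ->
    forall A, mono_star_alg A -> phi (T_perm sigma A) = phi A).

Let star_in A : mono_star_alg A -> M A := star_alg_cstar adj (A := A).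

Lemma phi_pos_proj_const i j : phi (@pos_proj R i) = phi (@pos_proj R j).
Proof.
have := phi_inv (swap_finite_perm i j) (hamel_star_alg R (seq_index [:: i] [:: i])).
by rewrite T_perm_hamel hamel_perm_swap hamel_single.
Qed.

(** The mixing coefficient x of the decomposition. *)
Definition vacuum_weight : R := complex.Re (phi (@pos_proj R 0)).
Local Notation w := vacuum_weight.

Lemma phi_pos_proj i : phi (@pos_proj R i) = w%:C.
Proof.
rewrite (phi_pos_proj_const i 0) /w.
have := state_pos phi_state (star_in (creation_star_alg R 0))
  (adjoint_sym (@annihilation_adjoint R 0)).
rewrite -[_ \o _]/(@pos_proj R 0) lecE.
by case: (phi _) => a b /= /andP[/eqP -> _].
Qed.

Lemma vacuum_weight_ge0 : 0 <= w.
Proof.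
have := state_pos phi_state (star_in (creation_star_alg R 0))
  (adjoint_sym (@annihilation_adjoint R 0)).
by rewrite -[_ \o _]/(@pos_proj R 0) phi_pos_proj lecR.
Qed.

Lemma vacuum_weight_le1 : w <= 1.
Proof.
have sP : is_adjoint (@pos_proj R 0) (@pos_proj R 0).
  exact: adjoint_comp (@annihilation_adjoint R 0) (adjoint_sym (@annihilation_adjoint R 0)).
have PP : @pos_proj R 0 \o @pos_proj R 0 = @pos_proj R 0.
  apply: op_eqP => x t st; rewrite -[LHS]/(fcoord (@pos_proj R 0 (@pos_proj R 0 x)) t).
  by rewrite !fcoord_pos_proj; case: (sorted _ _).
have MP := star_in (pos_proj_star_alg R 0).
have [_] := state_form_bound adj phi_state (cstar_id adj) MP (@adjoint_id R _) sP.
rewrite PP -[id \o _]/(@pos_proj R 0) -[id \o id]/(id : op) (state_unit phi_state).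
rewrite phi_pos_proj normc_real /= mul1r real_normK ?num_real// => h.
rewrite leNgt; apply/negP => w1.
by move: h; rewrite expr2 ger_pMr ?(lt_trans ltr01)// leNgt w1.
Qed.

(** By number_op this is the difference of two values of phi on the projections P_k,
    which coincide. *)
Lemma phi_number i : phi (creation i \o annihilation i) = 0.
Proof.
rewrite number_op (stateB phi_state); try exact: star_in (pos_proj_star_alg R _).
by rewrite !phi_pos_proj subrr.
Qed.

Lemma phi_word p q : (p != [::]) || (q != [::]) -> phi (word p (rev q)) = 0.
Proof.
case: p => [|i p] => [|_].
  case: q => // j q _; rewrite rev_cons.
  rewrite (_ : word _ _ = word [::] (rev q) \o annihilation j).
    apply: (state_null_right adj phi_state _ (@annihilation_adjoint R j) (phi_number j)).
      exact: star_in (annihilation_star_alg R j).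
    exact: star_in (word_star_alg R _ _).
  by rewrite /word /=; elim: (rev q) => //= a u ->.
rewrite -[word _ _]/(creation i \o word p (rev q)).
apply: (state_null_left adj phi_state _ (@annihilation_adjoint R i) (phi_number i)).
  exact: star_in (annihilation_star_alg R i).
exact: star_in (word_star_alg R _ _).
Qed.

Lemma phi_hamel l : phi (hamel l) =
  (1 - w)%:C * (l == vacuum_index)%:R + w%:C * entry (hamel l) [::] [::].
Proof.
have w1 : (1 - w)%:C + w%:C = 1 :> C by rewrite -rmorphD /= subrK.
rewrite entry_nil_hamel hamelE -/(is_single _ _).
have e0 : (l == vacuum_index) = (incr_enum l.1 == [::]) && (incr_enum l.2 == [::]).
  by rewrite -incr_enum0 !(inj_eq incr_enum_inj); case: l => I J; rewrite xpair_eqE.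
case: ifP => [s|_].
  rewrite orbT phi_pos_proj e0; have [j [-> _]] := single_or s.
  by rewrite mulr0 add0r mulr1.
rewrite orbF e0; case: (boolP (_ && _)) => [/andP[/eqP -> /eqP ->]|].
  by rewrite !mulr1 w1; exact: state_unit phi_state.
by rewrite negb_and => /phi_word ->; rewrite !mulr0 addr0.
Qed.

Lemma phi_lincomb (c : index -> C) : finite_set (fsupp c) ->
  phi (lincomb c) = (1 - w)%:C * c vacuum_index + w%:C * entry (lincomb c) [::] [::].
Proof.
move=> /fsupp_fset[F hF].
have phi_comb a A B : M A -> M B -> M (a *: A + B) /\ phi (a *: A + B) = a * phi A + phi B.
  exact (fun MA MB => conj (cstar_comb adj a MA MB) (state_linear phi_state a MA MB)).
rewrite (lincomb_functional (star_in (star_alg0 R))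
  (fun l => star_in (hamel_star_alg R l)) phi_comb hF).
rewrite (lincomb_entry _ _ hF) -(big_fset_delta hF) !mulr_sumr -big_split /=.
by apply: eq_bigr => l _; rewrite phi_hamel; ring.
Qed.

(** The decomposition is exact for finite combinations; the factor 3 adds the bound 2
    for phi and the bound 1 for the vacuum state. *)
Lemma phi_sub_vacuum_approx A (c : index -> C) (e : R) : M A -> finite_set (fsupp c) ->
  0 <= e -> bounded_by (A - lincomb c) e ->
  normc (phi A - w%:C * vacuum_state A - (1 - w)%:C * c vacuum_index) <= 3 * e.
Proof.
move=> MA fc e0 h; rewrite vacuum_stateE.
have Mc := lincomb_cstar fc.
move: (lincomb c) (phi_lincomb fc) Mc h => B phiB MB h.
have := state_bounded adj phi_state (cstarB adj MA MB) e0 h.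
have := @entry_bound _ _ _ [::] [::] h isT.
rewrite entryB (stateB phi_state MA MB) phiB.
set u := entry A _ _; set v := entry B _ _; set a := phi A; set g := _ * c _.
move=> huv hag.
rewrite (_ : _ - _ = (a - (g + w%:C * v)) - w%:C * (u - v)); last by ring.
apply: le_trans (le_normcD _ _) _; rewrite normcN normcM normc_real.
rewrite ger0_norm ?vacuum_weight_ge0//.
have := ler_wpM2r (normc_ge0 (u - v)) vacuum_weight_le1; rewrite mul1r => le_uv.
apply: le_trans (lerD hag (le_trans le_uv huv)) _.
by rewrite -[X in _ + X]mul1r -mulrDl ler_wpM2r//; lra.
Qed.

Lemma symmetric_state_decomposition A : M A ->
  phi A = (1 - w)%:C * state_at_infinity A + w%:C * vacuum_state A.
Proof.
move=> MA; have [bA approx] := (mono_cstarP A).1 MA.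
have [w1|w1] := eqVneq w 1.
  rewrite w1 subrr mul0r add0r mul1r; apply/eqP; rewrite -subr_eq0; apply/eqP/eq0_normc.
  apply: (@geometric_eq0 _ _ 3) => [|n]; first exact: normc_ge0.
  have e0 : 0 < (2^-1 : R) ^+ n by rewrite exprn_gt0// invr_gt0.
  have [c fc hc] := approx _ e0.
  by have := phi_sub_vacuum_approx MA fc (ltW e0) hc; rewrite w1 subrr mul0r subr0 mul1r.
have wl1 : 0 < 1 - w by rewrite subr_gt0 lt_neqAle w1 vacuum_weight_le1.
have wn0 : (1 - w)%:C != 0 by rewrite fmorph_eq0 gt_eqF.
(* The value that the decomposition forces on the state at infinity. *)
pose a := (phi A - w%:C * vacuum_state A) / (1 - w)%:C.
suff fA : frakA (A - a *: id).
  rewrite (state_at_infinityE fA) /a mulrC divfK// subrK//.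
have Ma : M (A - a *: id) := cstarB adj MA (cstarZ adj a (cstar_id adj)).
apply/frakAP; split; first exact: (cstar_bounded adj Ma).
(* With this d, the error 3 d / (1 - w) on the scalar and the error d on A add up
   to at most e. *)
move=> e e0; pose d := e * (1 - w) / 4.
have d0 : 0 < d by rewrite divr_gt0// mulr_gt0.
have [c fc hc] := approx _ d0.
have close : normc (a - c vacuum_index) <= 3 * d / (1 - w).
  have := phi_sub_vacuum_approx MA fc (ltW d0) hc.
  rewrite (_ : _ - _ = (1 - w)%:C * (a - c vacuum_index));
    last by rewrite mulrBr [_ * a]mulrC divfK.
  by rewrite normcM normc_real gtr0_norm// ler_pdivlMr// mulrC.
(* b is c with the coefficient of the identity removed. *)
pose b l : C := - c vacuum_index * delta R vacuum_index l + c l.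
have [fb bE] := lincomb_comb (- c vacuum_index) (delta_fsupp R vacuum_index) fc.
exists b; split => //; first by rewrite /b /delta eqxx mulr1 addNr.
rewrite bE lincomb_delta hamel_id.
rewrite (_ : _ - _ = (c vacuum_index - a) *: id + (A - lincomb c)).
  apply: bounded_by_le (bounded_by_comb _ (@bounded_by_id R _) hc).
  rewrite -normcN opprB mulr1; apply: le_trans (lerD close (lexx _)) _.
  have -> : 3 * d / (1 - w) = 3 / 4 * e by rewrite /d; field; rewrite gt_eqF.
  have : d <= e / 4.
    by rewrite /d -mulrA ler_wpM2l ?(ltW e0)// ler_piMl ?invr_ge0// gerBl vacuum_weight_ge0.
  lra.
rewrite scalerBl scaleNr opprD opprK.
by rewrite addrACA [RHS]addrACA [A + _]addrC.
Qed.

End SymmetricStates.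

Theorem proposition5p1 (R : realType)
    (phi : (l2 R incr_seq -> l2 R incr_seq) -> R[i])
    (phi_state : is_state (@mono_Cstar_alg R) phi)
    (phi_inv : forall sigma : int -> int, finite_perm sigma ->
      forall A, mono_star_alg A -> phi (T_perm sigma A) = phi A) :
  exists x : R, [/\ 0 <= x, x <= 1 &
    forall A, mono_Cstar_alg A ->
      phi A = (1 - x)%:C * state_at_infinity A + x%:C * vacuum_state A].

Proof.
exists (vacuum_weight phi); split; first exact: vacuum_weight_ge0.
  exact: vacuum_weight_le1.
by move=> A; exact: symmetric_state_decomposition.
Qed.
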